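(* Fix $(\vartheta,\kappa)\in(0,1)^2$, $r>0$, $a\ge 1$ with $\kappa>1-\vartheta$, an integer $m_0\ge 1$ and a constant $c_0>0$, and let $g=g(m_0,\vartheta,r)$. Consider the linear model $Y=X\beta+\sigma z$ in which $\beta$ follows ARW$(\vartheta,r,a,\mu)$ and $X$ follows RD$(\vartheta,\kappa,\Omega)$, where $\Omega\in\mathcal M_p(c_0,g)$ for all sufficiently large $p$. Then, as $p\to\infty$, $$\mathrm{Hamm}_p^*(\vartheta,\kappa,r,a,\Omega)\ \ge\ L_p\,\big[d_p(\mathcal G^{\diamond})\big]^{-1}\sum_{j=1}^p p^{-\rho_j^*(\vartheta,r,a,\Omega)}.$$
   Context: Setting: $p\to\infty$ is the asymptotic parameter and all objects may depend on $p$. One observes $Y=X\beta+\sigma z\in\mathbb R^n$, where $X$ is $n\times p$, $z\sim N(0,I_n)$ and $\sigma>0$ is known. Random design model RD$(\vartheta,\kappa,\Omega)$: $n=n_p=p^{\kappa}$ and the rows of $X$ are i.i.d. $N(0,\frac1n\Omega)$, where $\Omega$ is a $p\times p$ correlation matrix (positive definite, unit diagonal). Asymptotic Rare and Weak model ARW$(\vartheta,r,a,\mu)$: $\epsilon_p=p^{-\vartheta}$, $\tau_p=\sigma\sqrt{2r\log p}$, $b=(b_1,\dots,b_p)'$ has i.i.d. Bernoulli$(\epsilon_p)$ entries independent of $(X,z)$, and $\beta=b\circ\mu$ (entrywise product), with $\mu\in\Theta_p^*(\tau_p,a):=\{\mu\in\mathbb R^p:\ \tau_p\le|\mu_i|\le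 a\tau_p\ \forall i\}$. Hamming risk of an estimator $\hat\beta$: $H_p(\hat\beta;\epsilon_p,n_p,\mu,\Omega)=\mathbb E\big[\sum_{j=1}^p 1\{\mathrm{sgn}(\hat\beta_j)\ne\mathrm{sgn}(\beta_j)\}\big]$, the expectation being over $b$, $X$ and $z$. Minimax Hamming distance: $\mathrm{Hamm}_p^*(\vartheta,\kappa,r,a,\Omega)=\inf_{\hat\beta}\sup_{\mu\in\Theta_p^*(\tau_p,a)}H_p(\hat\beta;\epsilon_p,n_p,\mu,\Omega)$. $L_p$ denotes a positive multi-$\log(p)$ factor: $L_p p^{\delta}\to\infty$ and $L_pp^{-\delta}\to0$ as $p\to\infty$ for every fixed $\delta>0$. $\lambda_k^*(\Omega)$ is the minimum, over all $k\times k$ principal submatrices of $\Omega$, of their smallest eigenvalue. $g=g(m_0,\vartheta,r)$ is the smallest integer with $g\ge\max\{m_0,(\vartheta+r)^2/(2\vartheta r)\}$, and $\mathcal M_p(c_0,g)$ is the set of $p\times p$ correlation matrices $\Omega$ with $\lambda_g^*(\Omega)\ge c_0$. Exponents: for $V\subset\{1,\dots,p\}$ let $I_V\in\{0,1\}^p$ be its indicator vector and $B_V=\{I_V\circ\mu:\ \mu\in\Theta_p^*(\tau_p,a)\}$. Let $\alpha(\theta^{(0)},\theta^{(1)})=\tau_p^{-2}(\theta^{(0)}-\theta^{(1)})'\Omega(\theta^{(0)}-\theta^{(1)})$. For $V_0,V_1\subset\{1,\dots,p\}$ let $\alpha^*(V_0,V_1)=\min\{\alpha(\theta^{(0)},\theta^{(1)}):\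 \theta^{(i)}\in B_{V_i},\ i=0,1,\ \mathrm{sgn}(\theta^{(0)})\ne\mathrm{sgn}(\theta^{(1)})\}$, $$\eta(V_0,V_1)=\max\{|V_0|,|V_1|\}\vartheta+\frac14\Big[\Big(\sqrt{\alpha^*(V_0,V_1)r}-\frac{\big||V_1|-|V_0|\big|\vartheta}{\sqrt{\alpha^*(V_0,V_1)r}}\Big)_+\Big]^2,$$ with $x_+=\max\{x,0\}$, and $\rho_j^*(\vartheta,r,a,\Omega)=\min\{\eta(V_0,V_1):\ j\in V_0\cup V_1\}$. Graph of Least Favorables (GOLF) $\mathcal G^\diamond$: for each $j$ let $(V_{0j}^*,V_{1j}^* )$ be the minimizing pair in the definition of $\rho_j^*$ (ties broken by taking the lexicographically first pair); $\mathcal G^\diamond$ has vertex set $\{1,\dots,p\}$ and an edge between $j$ and $k$ iff $(V_{0j}^*\cup V_{1j}^* )\cap(V_{0k}^*\cup V_{1k}^* )\ne\emptyset$; $d_p(\mathcal G^\diamond)$ is its maximum degree.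
   Formalization: The factor [d_p]^{-1} is read as [max{d_p,1}]^{-1}, because d_p can be 0 (for example when Ω is the identity matrix), where the printed bound is undefined; for d_p ≥ 1 nothing changes. Ties among minimizing pairs may be broken in any way. *)

(* Defs.v *)
From HB Require Import structures.
From mathcomp Require Import all_boot all_order all_algebra.
From mathcomp Require Import all_classical all_reals all_analysis.
Set Implicit Arguments. Unset Strict Implicit. Unset Printing Implicit Defensive.
Import Order.TTheory GRing.Theory Num.Theory.
Import numFieldNormedType.Exports.
Local Open Scope classical_set_scope.
Local Open Scope ring_scope.

Section GolfDefs.
Variable R : realType.

Definition correlation_matrix (p : nat) (Om : 'M[R]_p) : Prop :=
  Om^T = Om /\ (forall i, Om i i = 1) /\
  (forall u : 'rV[R]_p, u != 0 -> 0 < (u *m Om *m u^T) 0 0).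

Definition principal_submx (p : nat) (A : 'M[R]_p) (S : {set 'I_p}) :
  'M[R]_#|S| :=
  \matrix_(i < #|S|, j < #|S|) A (enum_val i) (enum_val j).

Definition lambda_min (k : nat) (A : 'M[R]_k) : R :=
  inf [set a : R | eigenvalue A a].

Definition lambda_star (p k : nat) (Om : 'M[R]_p) : R :=
  inf [set lambda_min (principal_submx Om S) | S in [set S : {set 'I_p} | #|S| = k]].

Definition g_index (m0 : nat) (vt r : R) : nat :=
  `| Num.ceil (Num.max (m0%:R) ((vt + r) ^+ 2 / (2 * vt * r))) |%N.

Definition Mclass (p : nat) (c0 : R) (g : nat) (Om : 'M[R]_p) : Prop :=
  correlation_matrix Om /\ c0 <= lambda_star g Om.

Definition eps_p (vt : R) (p : nat) : R := p%:R `^ (- vt).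
Definition tau_p (sigma r : R) (p : nat) : R := sigma * Num.sqrt (2 * r * ln p%:R).
Definition n_p (kappa : R) (p : nat) : nat := `| Num.floor (p%:R `^ kappa) |%N.

Definition Theta (p : nat) (tau a : R) : set ('I_p -> R) :=
  [set mu | forall i, tau <= `|mu i| <= a * tau].

Definition consv (T : Type) (N : nat) (x : T) (v : 'I_N -> T) : 'I_N.+1 -> T :=
  fun i => match unlift ord0 i with None => x | Some j => v j end.

(* expectation over N i.i.d. copies, given the one-copy expectation operator E *)
Fixpoint iidE (T : Type) (t0 : T) (E : (T -> \bar R) -> \bar R) (N : nat) :
  (('I_N -> T) -> \bar R) -> \bar R :=
  match N return (('I_N -> T) -> \bar R) -> \bar R with
  | 0 => fun f => f (fun _ => t0)
  | N'.+1 => fun f => E (fun x => @iidE T t0 E N' (fun v => f (consv x v)))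
  end.
Arguments iidE [T] t0 E N.

Definition lebE (f : R -> \bar R) : \bar R := (\int[@lebesgue_measure R]_x f x)%E.

Definition std_normal_pdf (x : R) : R :=
  expR (- (x ^+ 2) / 2) / Num.sqrt (2 * pi).

Definition mvn_pdf (p : nat) (S : 'M[R]_p) (x : 'rV[R]_p) : R :=
  (Num.sqrt ((2 * pi) ^+ p * \det S))^-1 *
  expR (- (1 / 2) * (x *m invmx S *m x^T) 0 0).

Definition stdnormalE (f : R -> \bar R) : \bar R :=
  lebE (fun x => ((std_normal_pdf x)%:E * f x)%E).

(* E over a row x ~ N(0,S) in R^p (Lebesgue integral on R^p, iterated) *)
Definition mvnE (p : nat) (S : 'M[R]_p) (f : 'rV[R]_p -> \bar R) : \bar R :=
  iidE 0 lebE p (fun x => ((mvn_pdf S (\row_i x i))%:E * f (\row_i x i))%E).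

Definition designE (n p : nat) (Om : 'M[R]_p)
  (F : 'M[R]_(n, p) -> ('I_n -> R) -> \bar R) : \bar R :=
  iidE 0 (mvnE (n%:R^-1 *: Om)) n (fun rows =>
    iidE 0 stdnormalE n (fun z =>
      F (\matrix_(i, k) rows i 0 k) z)).

Definition estimator (n p : nat) := ('I_n -> R) -> 'M[R]_(n, p) -> ('I_p -> R).

Definition coord_sets (N : nat) : set (set ('I_N -> R)) :=
  [set A | exists (i : 'I_N) (B : set R), measurable B /\ A = [set v | B (v i)]].

Definition borel_fun (N : nat) (f : ('I_N -> R) -> R) : Prop :=
  forall B : set R, measurable B -> <<s @coord_sets N >> (f @^-1` B).

(* the data (Y, X) flattened into a vector of R^(n + n*p) *)
Definition data_Y (n p : nat) (v : 'I_(n + n * p) -> R) : 'I_n -> R :=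
  fun i => v (lshift (n * p) i).
Definition data_X (n p : nat) (v : 'I_(n + n * p) -> R) : 'M[R]_(n, p) :=
  \matrix_(i, k) v (rshift n (mxvec_index i k)).

Definition measurable_estimator (n p : nat) (est : estimator n p) : Prop :=
  forall j : 'I_p, borel_fun (fun v => est (data_Y v) (data_X v) j).

Definition beta_of (p : nat) (b : {ffun 'I_p -> bool}) (mu : 'I_p -> R) : 'I_p -> R :=
  fun j => (b j)%:R * mu j.

Definition Hamming_risk (sigma : R) (n p : nat) (est : estimator n p)
  (eps : R) (mu : 'I_p -> R) (Om : 'M[R]_p) : \bar R :=
  (\sum_(b : {ffun 'I_p -> bool})
     (\prod_(j < p) (if b j then eps else 1 - eps))%:E *
     designE Om (fun X z =>
       let beta := beta_of b mu in
       let Y := fun i => (\sum_(k < p) X i k * beta k + sigma * z i)%R in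
       ((\sum_(j < p) (Num.sg (est Y X j) != Num.sg (beta j) : nat))%N%:R)%:E))%E.

Definition Hamm_star (sigma vt kappa r a : R) (p : nat) (Om : 'M[R]_p) : \bar R :=
  ereal_inf [set ereal_sup [set Hamming_risk sigma est (eps_p vt p) mu Om
                            | mu in @Theta p (tau_p sigma r p) a]
            | est in [set est : estimator (n_p kappa p) p | measurable_estimator est]].

Definition B_set (p : nat) (tau a : R) (V : {set 'I_p}) : set 'rV[R]_p :=
  [set \row_i ((i \in V)%:R * mu i) | mu in @Theta p tau a].

Definition alpha_fn (p : nat) (tau : R) (Om : 'M[R]_p) (t0 t1 : 'rV[R]_p) : R :=
  tau ^- 2 * ((t0 - t1) *m Om *m (t0 - t1)^T) 0 0.

(* alpha^*(V0,V1) (a minimum, attained; written as an infimum) *)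
Definition alpha_star (p : nat) (tau a : R) (Om : 'M[R]_p) (V0 V1 : {set 'I_p}) : R :=
  inf [set alpha_fn tau Om t.1 t.2 | t in
        [set t : 'rV[R]_p * 'rV[R]_p | B_set tau a V0 t.1 /\ B_set tau a V1 t.2 /\
                                        map_mx Num.sg t.1 != map_mx Num.sg t.2]].

Definition eta (p : nat) (vt r tau a : R) (Om : 'M[R]_p) (V0 V1 : {set 'I_p}) : R :=
  let al := alpha_star tau a Om V0 V1 in
  (maxn #|V0| #|V1|)%:R * vt +
  (1 / 4) * (Num.max (Num.sqrt (al * r)
                      - `|(#|V1|)%:R - (#|V0|)%:R| * vt / Num.sqrt (al * r)) 0) ^+ 2.

Definition rho_star (p : nat) (vt r tau a : R) (Om : 'M[R]_p) (j : 'I_p) : R :=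
  inf [set eta vt r tau a Om V.1 V.2 | V in
        [set V : {set 'I_p} * {set 'I_p} | j \in V.1 :|: V.2]].

Definition is_rho_minimizer (p : nat) (vt r tau a : R) (Om : 'M[R]_p) (j : 'I_p)
  (V : {set 'I_p} * {set 'I_p}) : Prop :=
  j \in V.1 :|: V.2 /\ eta vt r tau a Om V.1 V.2 = rho_star vt r tau a Om j.

(* maximum degree of the GOLF built from the chosen minimizing pairs *)
Definition golf_max_degree (p : nat) (V : 'I_p -> {set 'I_p} * {set 'I_p}) : nat :=
  \max_(j < p) #|[set k : 'I_p | (k != j) &&
                   ~~ [disjoint (V j).1 :|: (V j).2 & (V k).1 :|: (V k).2]]|.

Definition multi_log (L : nat -> R) : Prop :=
  (forall p, 0 < L p) /\
  forall delta : R, 0 < delta ->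
    (fun p => L p * p%:R `^ delta) @ \oo --> +oo /\
    (fun p => L p * p%:R `^ (- delta)) @ \oo --> 0.

End GolfDefs.

(* Main.v *)
(* Sign errors on [D_j = V_0j \cup V_1j] cost at least as much as testing the
   two least favourable configurations of [rho_j] against each other.  Given [X],
   this is a test between two Gaussian means at distance [|X w| / sigma]; shifting
   both to an intermediate mean [t] turns the likelihood ratios into
   [exp (- t^2 d^2 / 2 - t <d, z>)] and [exp (- (1 - t)^2 d^2 / 2 + (1 - t) <d, z>)],
   and Markov's inequality for [d^2] and [<d, z>^2] bounds the total error by [p^(-eta) exp
     (- C h^3)],
   where [h^4 = log p].  Markov's inequality (rather than a concentration bound) is
   enough for [d^2], since a probability of order [1 / h^2] is only an [L_p] factor.

   The blocks [D_j], for [j] in a greedily chosen independent set of the GOLF, are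
   disjoint.  Giving each of them an independent fair coin that selects one of its
   two amplitude vectors yields a prior on [mu] under which the block errors add up.
   Comparison with [V_0 = \emptyset], [V_1 = {j}] gives [rho_j <= vt + r / 4], which
   bounds [|D_j|] and the separations uniformly in [j] and [p]. *)
Require Import Defs.
From HB Require Import structures.
From mathcomp Require Import all_boot all_order all_algebra.
From mathcomp Require Import all_classical all_reals all_analysis.
From mathcomp Require Import measurable_realfun.
From mathcomp Require Import ring lra.
Set Implicit Arguments. Unset Strict Implicit. Unset Printing Implicit Defensive.
Import Order.TTheory GRing.Theory Num.Theory.
Import numFieldNormedType.Exports.
Local Open Scope classical_set_scope.
Local Open Scope ring_scope.

(** * Affine substitutions in the lower Lebesgue integral *)

(** The supremum in the minimax risk is over a fixed [mu], while the two hypotheses of a block may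
    need different amplitudes even where their supports overlap. Hence the prior on [mu]; averaging
    over its coins at the end returns a single deterministic [mu] doing at least as well. The bound
    for one block holds with everything outside the block frozen, so the blocks are added by
    linearity alone, and disjointness only serves to count no coordinate twice.

    The scale h^3 sits between the standard deviation of <d, z>, of order h^2, and log p = h^4: a
    threshold of order h^3 is exceeded with probability of order h^(-2), yet moves the exponent by
    o(log p). A relative slack h^(-2) in d^2 moves it by O(h^2). Since the rows have covariance
    Omega / n, the mean of d^2 does not involve n.

    The risk is an iterated integral over function types, where additivity needs measurability but
    monotonicity and scaling do not. The operators are therefore handled through a short list of
    axioms that is stable under products and images. *)

Section LowerIntegral.
Context {R : realType}.
Local Notation mu := (@lebesgue_measure R).
Local Notation MR := (measurableTypeR R).
Import HBNNSimple.

(* The integral of a nonnegative function is a supremum over simple functions, so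
   monotonicity, scaling and affine substitution need no measurability of [f]. *)
Lemma lebE_le (f g : R -> \bar R) : (forall x, 0 <= f x)%E ->
  (forall x, f x <= g x)%E -> (lebE f <= lebE g)%E.
Proof.
move=> f0 fg; have g0 x : (0 <= g x)%E by exact: le_trans (fg x).
rewrite /lebE !ge0_integralTE//; apply: ereal_sup_le => _ [h hf <-].
by exists h => // x; exact: le_trans (fg x).
Qed.

Lemma lebE_ge0 (f : R -> \bar R) : (forall x, 0 <= f x)%E -> (0 <= lebE f)%E.
Proof. by move=> f0; apply: integral_ge0. Qed.

(** A simple function below [f] is measurable, so the change of variables applies to it, and its
    image lies below [f \o A]. The factor [k] stays inside the integral because pulling a scalar out
    for arbitrary [f] is itself an instance of the substitution, see [lebEZ]. *)
Lemma lebE_subst_le (A : MR -> MR) (c k : R) (f : R -> \bar R) :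
  measurable_fun setT A -> 0 < c -> 0 < k ->
  (forall S : set MR, measurable S -> mu S = c%:E * mu (A @^-1` S))%E ->
  (forall x, 0 <= f x)%E ->
  (lebE f <= (c / k)%:E * lebE (fun x => k%:E * f (A x)))%E.
Proof.
move=> mA c0 k0 muA f0.
rewrite {1}/lebE ge0_integralTE//; apply: ge_ereal_sup => _ [h hf <-].
rewrite -integralT_nnsfun.
pose m' : {measure set MR -> \bar R} := mscale (NngNum (ltW c0)) (pushforward mu A).
have m'E S : m' mA S = (c%:E * mu (A @^-1` S))%E by [].
have -> : (\int[mu]_x (h x)%:E = \int[m' mA]_x (h x)%:E)%E.
  by apply: (@eq_measure_integral _ _ _ _ (m' mA)) => S mS _; rewrite m'E; exact: muA.
have mh : measurable_fun setT (EFin \o h).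
  by apply/measurable_EFinP; exact: measurable_funP.
have h0 x : (0 <= (EFin \o h) x)%E by rewrite lee_fin.
have -> : (\int[m' mA]_x (h x)%:E = c%:E * \int[mu]_x (h (A x))%:E)%E.
  rewrite -[X in integral (m' _) _ X]/(EFin \o h) /m'.
  rewrite ge0_integral_mscale; [|by []|exact: mh|by move=> x _; exact: h0].
  congr (_ * _)%E; rewrite (ge0_integral_pushforward mA).
  - by rewrite preimage_setT.
  - exact: measurableT.
  - exact: mh.
  - by move=> x _; exact: h0.
rewrite EFinM -muleA; apply: lee_wpmul2l; first by rewrite lee_fin ltW.
rewrite -lee_pdivrMl ?invr_gt0// invrK.
rewrite -ge0_integralZl_EFin; last 4 first.
- by [].
- by move=> x _; exact: h0.
- exact: measurableT_comp mh mA.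
- exact: ltW.
apply: lebE_le => x; first by rewrite mule_ge0// lee_fin// ltW.
by apply: lee_wpmul2l; [rewrite lee_fin ltW | exact: hf].
Qed.

(** The reverse inequality is [lebE_subst_le] for the inverse map [B], applied to the transformed
    integrand. *)
Lemma lebE_subst (A B : MR -> MR) (c k : R) (f : R -> \bar R) :
  measurable_fun setT A -> measurable_fun setT B -> cancel A B -> cancel B A ->
  0 < c -> 0 <= k ->
  (forall S : set MR, measurable S -> mu S = c%:E * mu (A @^-1` S))%E ->
  (forall x, 0 <= f x)%E ->
  (lebE (fun x => k%:E * f (A x)) = (k / c)%:E * lebE f)%E.
Proof.
move=> mA mB AB BA c0; rewrite le_eqVlt => /predU1P[<- _ _|k0 muA f0].
  under eq_fun do rewrite mul0e.
  by rewrite mul0r mul0e; exact: integral0.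
have c'0 : 0 < c^-1 by rewrite invr_gt0.
have k'0 : 0 < k^-1 by rewrite invr_gt0.
apply/eqP; rewrite eq_le; apply/andP; split; last first.
  rewrite -lee_pdivlMl ?divr_gt0// invf_div.
  exact: lebE_subst_le.
have fE : (fun x => k^-1%:E * (k%:E * f (A (B x))))%E = f.
  by apply/funext => x; rewrite BA muleA -EFinM mulVf ?gt_eqF// mul1e.
have /= := @lebE_subst_le B c^-1 k^-1 (fun x => k%:E * f (A x))%E mB c'0 k'0.
rewrite fE invrK [_^-1 * _]mulrC.
apply => [S mS|x]; last by rewrite mule_ge0// lee_fin ltW.
rewrite (muA (B @^-1` S)); last by rewrite -[X in measurable X]setTI; exact: mB.
rewrite muleA -EFinM mulVf ?gt_eqF// mul1e; congr (mu _).
by apply/seteqP; split => x; rewrite /preimage/= AB.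
Qed.

Lemma lebE_affine (l b k : R) (f : R -> \bar R) : 0 < l -> 0 <= k ->
  (forall x, 0 <= f x)%E ->
  (lebE (fun x => k%:E * f (l * x + b)%R) = (k / l)%:E * lebE f)%E.
Proof.
move=> l0 k0 f0; have mA : measurable_fun (setT : set MR) ((fun x => l * x + b) : MR -> MR).
  by apply: measurable_funD => //; apply: measurable_funM.
apply: (@lebE_subst (fun x => l * x + b) (fun x => l^-1 * (x - b)) l k f) => //.
- by apply: measurable_funM => //; apply: measurable_funB.
- by move=> x /=; rewrite addrK mulKf// gt_eqF.
- by move=> x /=; rewrite mulVKf ?gt_eqF// subrK.
pose m' : {measure set MR -> \bar R} :=
  mscale (NngNum (ltW l0)) (pushforward mu (fun x : MR => l * x + b : MR)).
apply: (@lebesgue_measure_unique R (m' mA)) => _ [[u v]] _ <-.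
have pe : (fun x : R => l * x + b) @^-1` `]u, v] = `](u - b) / l, (v - b) / l]%classic.
  apply/seteqP; split => x /=; rewrite !in_itv/=.
    by rewrite ltr_pdivrMr// ler_pdivlMr// ltrBlDr lerBrDr ![x * l]mulrC.
  by rewrite ltr_pdivrMr// ler_pdivlMr// ltrBlDr lerBrDr ![x * l]mulrC.
rewrite [RHS](_ : _ = l%:E * mu ((fun x : R => (l * x + b)%R) @^-1` `]u, v]))%E// pe.
rewrite !lebesgue_measure_itv/= !lte_fin ltr_pM2r ?invr_gt0// ltrD2r.
case: ifP => _; last by rewrite mule0.
by rewrite -!EFinB -EFinM; congr (_%:E); field; rewrite gt_eqF.
Qed.

Lemma lebEZ (k : R) (f : R -> \bar R) : 0 <= k -> (forall x, 0 <= f x)%E ->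
  (lebE (fun x => k%:E * f x) = k%:E * lebE f)%E.
Proof.
move=> k0 f0; have := @lebE_affine 1 0 k f ltr01 k0 f0.
by under eq_fun do rewrite mul1r addr0; rewrite divr1.
Qed.

Lemma lebE_opp (f : R -> \bar R) : (forall x, 0 <= f x)%E ->
  lebE (fun x => f (- x)%R) = lebE f.
Proof.
move=> f0; have mA : measurable_fun (setT : set MR) (-%R : MR -> MR) by [].
have := @lebE_subst -%R -%R 1 1 f mA mA (@opprK _) (@opprK _) ltr01 ler01.
rewrite divr1 mul1e; under eq_fun do rewrite mul1e.
by apply => // S mS; rewrite mul1e -(lebesgue_measureN mS).
Qed.

End LowerIntegral.

(** * Expectation operators and the standard normal law *)

(* Measurability of functions on [T] is tested along measurable families of points
   of [T] ("plots", as in quasi-Borel spaces); this avoids sigma-algebras on the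
   function types over which [iidE] integrates. *)
Definition plots (T : Type) := forall d (S : measurableType d), (S -> T) -> Prop.

Definition qmeasurable (R : realType) (T : Type) (pl : plots T) (f : T -> \bar R) :=
  forall d (S : measurableType d) (u : S -> T), pl d S u ->
    measurable_fun setT (fun s => f (u s)).

Record is_plots (T : Type) (pl : plots T) : Prop := IsPlots {
  plots_cst : forall d (S : measurableType d) (x : T), pl d S (fun _ => x);
  plots_comp : forall d d' (S : measurableType d) (S' : measurableType d')
    (w : S' -> S) (u : S -> T), measurable_fun setT w -> pl d S u ->
    pl d' S' (fun s => u (w s)) }.

(** Only additivity asks for measurability of the integrand. The last clause is of Tonelli type:
    integrals depend measurably on parameters, which is what lets the axioms pass to iterated
    operators. *)
Record expectation_op (R : realType) (T : Type) (pl : plots T)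
    (E : (T -> \bar R) -> \bar R) : Prop := Expectation {
  expect_plots : is_plots pl;
  expect_le : forall f g, (forall t, 0 <= f t)%E -> (forall t, f t <= g t)%E ->
    (E f <= E g)%E;
  expectZ : forall (k : R) f, 0 <= k -> (forall t, 0 <= f t)%E ->
    E (fun t => k%:E * f t)%E = (k%:E * E f)%E;
  expect1 : E (fun _ => 1%E) = 1%E;
  expectD : forall f g, (forall t, 0 <= f t)%E -> (forall t, 0 <= g t)%E ->
    qmeasurable pl f -> qmeasurable pl g ->
    E (fun t => f t + g t)%E = (E f + E g)%E;
  expect_measurable : forall d (S : measurableType d) (f : S -> T -> \bar R),
    (forall s t, 0 <= f s t)%E ->
    (forall d' (S' : measurableType d') (w : S' -> S) (u : S' -> T),
       measurable_fun setT w -> pl d' S' u ->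
       measurable_fun setT (fun s => f (w s) (u s))) ->
    measurable_fun setT (fun s => E (f s)) }.

Section ExpectationTheory.
Context {R : realType} {T : Type} {pl : plots T} {E : (T -> \bar R) -> \bar R}.
Hypothesis hE : expectation_op pl E.

Lemma expect_cst (k : R) : 0 <= k -> E (fun _ => k%:E) = k%:E.
Proof.
move=> k0; have := expectZ hE k0 (fun _ : T => @lee01 R).
by under eq_fun do rewrite mule1; rewrite (expect1 hE) mule1.
Qed.

Lemma expect_ge0 f : (forall t, 0 <= f t)%E -> (0 <= E f)%E.
Proof.
move=> f0; rewrite -[leLHS](@expect_cst 0 (lexx _)).
exact: (expect_le hE).
Qed.

End ExpectationTheory.

Section StandardNormal.
Context {R : realType}.
Local Notation mu := (@lebesgue_measure R).
Local Notation MR := (measurableTypeR R).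
Local Notation pdf := (@std_normal_pdf R).

Definition real_plots : plots R := fun d S u => measurable_fun setT u.

Lemma std_normal_pdf_ge0 (x : R) : 0 <= pdf x.
Proof. by rewrite mulr_ge0 ?expR_ge0// invr_ge0 sqrtr_ge0. Qed.

Lemma measurable_std_normal_pdf : measurable_fun setT pdf.
Proof.
apply: measurable_funM => //; apply: measurableT_comp => //.
apply: measurable_funM => //; apply: measurableT_comp => //.
Qed.

Lemma stdnormalE_ge0 (f : R -> \bar R) : (forall x, 0 <= f x)%E ->
  (0 <= stdnormalE f)%E.
Proof.
by move=> f0; apply: lebE_ge0 => x; rewrite mule_ge0// lee_fin std_normal_pdf_ge0.
Qed.

Lemma stdnormalE1 : stdnormalE (fun _ : R => 1%E) = 1%E :> \bar R.
Proof.
rewrite -[RHS](integral_normal_pdf (0 : R) 1); apply: eq_integral => x _.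
rewrite mule1 /normal_pdf oner_eq0 /normal_peak /normal_fun /std_normal_pdf.
rewrite expr1n subr0 mulrC mul1r mulr_natl.
by rewrite mulr2n.
Qed.

Lemma stdnormalE_shift (d : R) (f : R -> \bar R) : (forall x, 0 <= f x)%E ->
  stdnormalE (fun z => f (z + d)) =
  stdnormalE (fun z => (expR (d * z - d ^+ 2 / 2))%:E * f z)%E.
Proof.
move=> f0; rewrite /stdnormalE.
pose g z := ((pdf (z - d))%:E * f z)%E.
have g0 x : (0 <= g x)%E by rewrite mule_ge0// lee_fin std_normal_pdf_ge0.
transitivity (lebE (fun x => 1%:E * g (1 * x + d)%R)%E).
  by congr lebE; apply/funext => x; rewrite mul1e mul1r /g addrK.
rewrite lebE_affine// divr1 mul1e; congr lebE; apply/funext => x.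
rewrite muleA -EFinM /g; congr (_%:E * _)%E.
rewrite /std_normal_pdf mulrAC -expRD; congr (expR _ / _).
by field.
Qed.

Lemma stdnormalE_opp (f : R -> \bar R) : (forall x, 0 <= f x)%E ->
  stdnormalE (fun z => f (- z)%R) = stdnormalE f.
Proof.
move=> f0; rewrite /stdnormalE -[RHS]lebE_opp; last first.
  by move=> x; rewrite mule_ge0// lee_fin std_normal_pdf_ge0.
by congr lebE; apply/funext => x; rewrite /std_normal_pdf sqrrN.
Qed.

Lemma expectation_stdnormalE : expectation_op real_plots (@stdnormalE R).
Proof.
have pdf0 x : (0 <= (pdf x)%:E)%E by rewrite lee_fin std_normal_pdf_ge0.
split.
- split=> [d S x|d d' S S' w u mw mu_]; first exact: measurable_cst.
  exact: measurableT_comp mw.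
- move=> f g f0 fg; apply: lebE_le => x; first by rewrite mule_ge0.
  exact: lee_wpmul2l.
- move=> k f k0 f0; rewrite /stdnormalE -lebEZ// => [|x]; last by rewrite mule_ge0.
  by congr lebE; apply/funext => x; rewrite muleCA.
- exact: stdnormalE1.
- move=> f g f0 g0 mf mg; rewrite /stdnormalE /lebE -ge0_integralD//.
  + by apply: eq_integral => x _; rewrite ge0_muleDr.
  + by move=> x _; rewrite mule_ge0.
  + apply: emeasurable_funM; last by apply: (mf _ MR id); exact: measurable_id.
    by apply/measurable_EFinP; exact: measurable_std_normal_pdf.
  + by move=> x _; rewrite mule_ge0.
  + apply: emeasurable_funM; last by apply: (mg _ MR id); exact: measurable_id.
    by apply/measurable_EFinP; exact: measurable_std_normal_pdf.
- move=> d S f f0 mf.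
  apply: (@measurable_fun_fubini_tonelli_F _ _ S MR R mu
    (fun sx => (pdf sx.2)%:E * f sx.1 sx.2)%E).
  + apply: emeasurable_funM.
      apply/measurable_EFinP; apply: measurableT_comp.
        exact: measurable_std_normal_pdf.
      exact: measurable_snd.
    by apply: (mf _ (S * MR)%type fst snd); [exact: measurable_fst|exact: measurable_snd].
  + by move=> x; rewrite mule_ge0.
Qed.

(* The bound [1 + h x^2 / 2 <= exp (h x^2 / 2)] with [h = 1 - l^2] compares the
   second moment with the mass of a normal density of variance [1 / l^2]. *)
Lemma stdnormalE_sqr_le1 : (stdnormalE (fun z : R => (z ^+ 2)%:E) <= 1)%E.
Proof.
set m := stdnormalE _.
have m0 : (0 <= m)%E by apply: stdnormalE_ge0 => x; rewrite lee_fin sqr_ge0.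
have key (l : R) : 0 < l < 1 -> (1 + ((1 - l ^+ 2) / 2)%:E * m <= (l^-1)%:E)%E.
  move=> /andP[l0 l1]; have h0 : 0 <= (1 - l ^+ 2) / 2.
    by rewrite divr_ge0// subr_ge0 expr_le1// ltW.
  rewrite -(expectZ expectation_stdnormalE h0); last first.
    by move=> x; rewrite lee_fin sqr_ge0.
  rewrite -stdnormalE1 -(expectD expectation_stdnormalE); last 4 first.
  - by [].
  - by move=> x; rewrite mule_ge0// lee_fin ?sqr_ge0.
  - by move=> d S u _; exact: measurable_cst.
  - move=> d S u mu_; apply: emeasurable_funM; first exact: measurable_cst.
    by apply/measurable_EFinP; exact: measurable_funX.
  rewrite [leRHS](_ : _ = lebE (fun x => 1%:E * (pdf (l * x + 0))%:E)%E).
    apply: lebE_le => x.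
      rewrite mule_ge0 ?lee_fin ?std_normal_pdf_ge0//.
      by rewrite addr_ge0// mulr_ge0// sqr_ge0.
    rewrite mul1e addr0 [leLHS](_ : _ = (pdf x * (1 + (1 - l ^+ 2) / 2 * x ^+ 2))%:E)//
      lee_fin /std_normal_pdf.
    rewrite mulrAC ler_wpM2r ?invr_ge0 ?sqrtr_ge0//.
    rewrite -(@ler_pM2l _ (expR (- (- x ^+ 2 / 2)))) ?expR_gt0//.
    rewrite mulrA -!expRD addNr expR0 mul1r.
    apply: le_trans (expR_ge1Dx _); rewrite lerD2l.
    by rewrite le_eqVlt; apply/orP; left; apply/eqP; field.
  rewrite (@lebE_affine _ l 0 1 (fun y => (pdf y)%:E))// => [|x];
    last by rewrite lee_fin std_normal_pdf_ge0.
  rewrite mul1r -[LHS]mule1; congr (_ * _)%E; rewrite -[LHS]stdnormalE1.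
  by congr lebE; apply/funext => x; rewrite mule1.
(* The value [l = 1/2] only serves to show that the second moment is finite. *)
have half : 0 < (2^-1 : R) < 1 by rewrite invr_gt0 ltr0n invf_lt1// ltr1n.
have mfin : m \is a fin_num.
  rewrite ge0_fin_numE//; case: m m0 key => [m| |]//= _ /(_ _ half).
    by rewrite ltry.
  by rewrite gt0_muley ?addey// lte_fin; lra.
rewrite -(fineK mfin) lee_fin in m0 *; set x := fine m in m0 *.
rewrite leNgt; apply/negP; rewrite lte_fin => x1.
(* With [l = 1 - e], [key] reads [1 + x e <= 1 + e] to first order, which fails for [x > 1] and
   small [e]. For this [e] the second-order loss [3 e x / 2] takes only half of the gain [x - 1]. *)
pose l := 1 - (x - 1) / (3 * x).
have x0 : 0 < x by lra.
have e0 : 0 < (x - 1) / (3 * x) by rewrite divr_gt0; lra.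
have e1 : (x - 1) / (3 * x) < 1 by rewrite ltr_pdivrMr; lra.
have xe : (x - 1) / (3 * x) * x = (x - 1) / 3 by field; lra.
have /key : 0 < l < 1 by rewrite /l; lra.
rewrite -(fineK mfin) -/x -EFinM -EFinD lee_fin.
rewrite -[l^-1]div1r ler_pdivlMr; last by rewrite /l; lra.
rewrite -/(l) {}/l; move: ((x - 1) / (3 * x)) e0 e1 xe => e e0 e1 xe.
nra.
Qed.

End StandardNormal.

(** * Iterated expectations *)

Section ProductExpectation.
Context {R : realType}.

Lemma expectation_image (T1 T2 : Type) (pl1 : plots T1) (pl2 : plots T2)
    (E : (T1 -> \bar R) -> \bar R) (h : T1 -> T2) :
  is_plots pl2 -> expectation_op pl1 E ->
  (forall d (S : measurableType d) u, pl1 d S u -> pl2 d S (fun s => h (u s))) ->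
  expectation_op pl2 (fun f => E (fun x => f (h x))).
Proof.
move=> hpl hE hh; split=> //.
- by move=> f g f0 fg; apply: (expect_le hE).
- by move=> k f k0 f0; rewrite (expectZ hE).
- exact: expect1 hE.
- move=> f g f0 g0 mf mg; apply: (expectD hE) => // d S u plu.
    by apply: (mf d S (fun s => h (u s))); exact: hh.
  by apply: (mg d S (fun s => h (u s))); exact: hh.
- move=> d S f f0 mf; apply: (expect_measurable hE) => // d' S' w u mw plu.
  by apply: (mf d' S' w (fun s => h (u s))) => //; exact: hh.
Qed.

Definition prod_plots (T1 T2 : Type) (pl1 : plots T1) (pl2 : plots T2) :
    plots (T1 * T2) :=
  fun d S u => pl1 d S (fun s => (u s).1) /\ pl2 d S (fun s => (u s).2).

(** Inner additivity freezes [x], which uses constant plots; the outer operator then needs the inner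
    integral to be measurable in [x], which is the Tonelli clause for the second factor. *)
Lemma expectation_prod (T1 T2 : Type) (pl1 : plots T1) (pl2 : plots T2)
    (E1 : (T1 -> \bar R) -> \bar R) (E2 : (T2 -> \bar R) -> \bar R) :
  expectation_op pl1 E1 -> expectation_op pl2 E2 ->
  expectation_op (prod_plots pl1 pl2) (fun f => E1 (fun x => E2 (fun y => f (x, y)))).
Proof.
move=> h1 h2; have [c1 k1] := expect_plots h1; have [c2 k2] := expect_plots h2.
split.
- split=> [d S x|d d' S S' w u mw [pl1u pl2u]]; first by split; [exact: c1|exact: c2].
  by split; [exact: (k1 _ _ _ _ w (fun s => (u s).1))|
             exact: (k2 _ _ _ _ w (fun s => (u s).2))].
- move=> f g f0 fg; apply: (expect_le h1) => x; first exact: expect_ge0 h2 _ _.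
  exact: (expect_le h2).
- move=> k f k0 f0; rewrite -(expectZ h1) => // [|x]; last exact: (expect_ge0 h2).
  by congr E1; apply/funext => x; rewrite (expectZ h2).
- by rewrite -[RHS](expect1 h1); congr E1; apply/funext => x; exact: expect1 h2.
- move=> f g f0 g0 mf mg; rewrite -(expectD h1).
  + congr E1; apply/funext => x; rewrite -(expectD h2)//.
      by move=> d S u plu; apply: (mf d S (fun s => (x, u s))); split => //; exact: c1.
    by move=> d S u plu; apply: (mg d S (fun s => (x, u s))); split => //; exact: c1.
  + by move=> x; exact: (expect_ge0 h2).
  + by move=> x; exact: (expect_ge0 h2).
  + move=> d S u plu; apply: (expect_measurable h2) => // d' S' w v mw plv.
    by apply: (mf d' S' (fun s => (u (w s), v s))); split => //; exact: (k1 _ _ _ _ w u).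
  + move=> d S u plu; apply: (expect_measurable h2) => // d' S' w v mw plv.
    by apply: (mg d' S' (fun s => (u (w s), v s))); split => //; exact: (k1 _ _ _ _ w u).
- move=> d S f f0 mf.
  apply: (expect_measurable h1 (f := fun s x => E2 (fun y => f s (x, y)))).
    by move=> s x; exact: (expect_ge0 h2).
  move=> d' S' w u mw plu.
  apply: (expect_measurable h2 (f := fun s y => f (w s) (u s, y))) => //.
  move=> d'' S'' w' v mw' plv.
  apply: (mf d'' S'' (fun s => w (w' s)) (fun s => (u (w' s), v s))).
    exact: measurableT_comp mw'.
  by split => //; exact: (k1 _ _ _ _ w' u).
Qed.

Definition iid_plots (T : Type) (pl : plots T) (N : nat) : plots ('I_N -> T) :=
  fun d S u => forall i, pl d S (fun s => u s i).

Lemma iid_is_plots (T : Type) (pl : plots T) (N : nat) :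
  is_plots pl -> is_plots (@iid_plots T pl N).
Proof.
move=> [c k]; split=> [d S x i|d d' S S' w u mw plu i]; first exact: c.
exact: (k _ _ _ _ w (fun s => u s i)).
Qed.

Lemma consv0 (T : Type) N (x : T) (v : 'I_N -> T) : consv x v ord0 = x.
Proof. by rewrite /consv unlift_none. Qed.

Lemma consv_lift (T : Type) N (x : T) (v : 'I_N -> T) i :
  consv x v (lift ord0 i) = v i.
Proof. by rewrite /consv liftK. Qed.

Lemma expectation_iidE (T : Type) (pl : plots T) (t0 : T)
    (E : (T -> \bar R) -> \bar R) (N : nat) :
  expectation_op pl E -> expectation_op (@iid_plots T pl N) (iidE (N := N) t0 E).
Proof.
move=> hE; elim: N => [|N IH].
  split=> //=; first exact: iid_is_plots (expect_plots hE).
  - move=> d S f f0 mf.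
    by apply: (mf d S id (fun _ _ => t0)) => // -[].
apply: (expectation_image (h := fun xv => consv xv.1 xv.2) _ (expectation_prod hE IH)).
  exact: iid_is_plots (expect_plots hE).
move=> d S u [pl1 pl2] i; rewrite /consv.
by case: (unlift ord0 i) => [j|]; [exact: pl2|exact: pl1].
Qed.

Lemma iidES (T : Type) (t0 : T) (E : (T -> \bar R) -> \bar R) N f :
  iidE (N := N.+1) t0 E f = E (fun x => iidE (N := N) t0 E (fun v => f (consv x v))).
Proof. by []. Qed.

Lemma expectation_iid_normal N :
  expectation_op (iid_plots real_plots (N := N)) (iidE (N := N) 0 (@stdnormalE R)).
Proof. exact: expectation_iidE expectation_stdnormalE. Qed.

(** The Cameron-Martin formula, obtained one coordinate at a time. *)
Lemma iid_normal_shift N (d : 'I_N -> R) (f : ('I_N -> R) -> \bar R) :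
  (forall v, 0 <= f v)%E ->
  iidE (N := N) 0 (@stdnormalE R) (fun v => f (fun i => v i + d i)) =
  iidE (N := N) 0 (@stdnormalE R)
    (fun v => (expR (\sum_i d i * v i - (\sum_i d i ^+ 2) / 2))%:E * f v)%E.
Proof.
elim: N d f => [|N IH] d f f0.
  rewrite /= !big_ord0 mul0r subr0 expR0 mul1e; congr f.
  by apply/funext => -[].
pose d' i := d (lift ord0 i).
rewrite !iidES.
transitivity (stdnormalE (fun x => iidE (N := N) 0 (@stdnormalE R)
    (fun v => f (consv (x + d ord0) (fun i => v i + d' i))))).
  congr stdnormalE; apply/funext => x; congr iidE; apply/funext => v; congr f.
  apply/funext => i; case: (unliftP ord0 i) => [j|] ->.
    by rewrite !consv_lift.
  by rewrite !consv0.
have hN := expectation_iid_normal N.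
rewrite (stdnormalE_shift (d ord0) (f := fun y => iidE (N := N) 0 (@stdnormalE R)
    (fun v => f (consv y (fun i => v i + d' i))))); last first.
  by move=> x; apply: (expect_ge0 hN).
congr stdnormalE; apply/funext => x.
rewrite (IH d' (fun v => f (consv x v)))// -(expectZ hN) ?expR_ge0//; last first.
  by move=> v; rewrite mule_ge0// lee_fin expR_ge0.
congr iidE; apply/funext => v; rewrite muleA -EFinM -expRD; congr ((expR _)%:E * _)%E.
rewrite !big_ord_recl !consv0; under [in RHS]eq_bigr do rewrite consv_lift.
by rewrite /d'; field.
Qed.

(** Adding the reflected integrand [z -> - z] cancels the cross term [2 a b z], so no signed
    integral is needed. *)
Lemma stdnormalE_sqr_affine (a b : R) :
  (stdnormalE (fun z : R => ((a + b * z) ^+ 2)%:E) <= (a ^+ 2 + b ^+ 2)%:E)%E.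
Proof.
set q := stdnormalE _.
have hE := @expectation_stdnormalE R.
have sq0 (g : R -> R) x : (0 <= (g x ^+ 2)%:E)%E by rewrite lee_fin sqr_ge0.
have q0 : (0 <= q)%E by exact: expect_ge0 hE _ _.
have mq (c e : R) : qmeasurable real_plots (fun z => ((c + e * z) ^+ 2)%:E).
  move=> d S u mu_; apply/measurable_EFinP; apply: measurable_funX.
  by apply: measurable_funD => //; exact: measurable_funM.
have qN : q = stdnormalE (fun z : R => ((a + (- b) * z) ^+ 2)%:E).
  rewrite /q -[LHS]stdnormalE_opp//; congr stdnormalE; apply/funext => z.
  by rewrite mulrN mulNr.
have : (q + q <= (2 * (a ^+ 2 + b ^+ 2))%:E)%E.
  rewrite {2}qN -(expectD hE)//.
  rewrite [leLHS](_ : _ = stdnormalE (fun z : R => (2 * a ^+ 2)%:E +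
      (2 * b ^+ 2)%:E * (z ^+ 2)%:E))%E; last first.
    by congr stdnormalE; apply/funext => z; rewrite -!EFinM -!EFinD; congr EFin; ring.
  have b0 : 0 <= 2 * b ^+ 2 by rewrite mulr_ge0// sqr_ge0.
  have a0 : 0 <= 2 * a ^+ 2 by rewrite mulr_ge0// sqr_ge0.
  rewrite (expectD hE).
  - rewrite (expect_cst hE)// (expectZ hE b0 (sq0 id)) mulrDr EFinD leeD2l//.
    by rewrite -[leRHS]mule1 lee_wpmul2l ?lee_fin// stdnormalE_sqr_le1.
  - by move=> _; rewrite lee_fin.
  - by move=> z; rewrite mule_ge0// lee_fin sqr_ge0.
  - by move=> d S u _; exact: measurable_cst.
  - move=> d S u mu_; apply/measurable_EFinP; apply: measurable_funM => //.
    exact: measurable_funX.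
by case: q q0 {qN} => [q| |]//= _; rewrite -EFinD !lee_fin; lra.
Qed.

(** The constant [a] is there for the induction: it absorbs the coordinate that is not yet
    integrated. *)
Lemma iid_normal_sqr_affine N (a : R) (d : 'I_N -> R) :
  (iidE (N := N) 0%R (@stdnormalE R) (fun v => ((a + \sum_i d i * v i) ^+ 2)%:E) <=
   (a ^+ 2 + \sum_i d i ^+ 2)%:E)%E.
Proof.
elim: N a d => [|N IH] a d; first by rewrite /= !big_ord0 !addr0.
have hE := @expectation_stdnormalE R; have hN := expectation_iid_normal N.
pose d' i := d (lift ord0 i).
rewrite iidES big_ord_recl addrA.
have s0 : 0 <= \sum_i d' i ^+ 2 by apply: sumr_ge0 => i _; exact: sqr_ge0.
apply: (@le_trans _ _ (stdnormalE (fun z : R => ((a + d ord0 * z) ^+ 2)%:E +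
    (\sum_i d' i ^+ 2)%:E)%E)).
  apply: (expect_le hE) => x.
    by apply: (expect_ge0 hN) => v; rewrite lee_fin sqr_ge0.
  rewrite -EFinD; apply: le_trans (IH _ _); rewrite le_eqVlt; apply/orP; left.
  apply/eqP; congr iidE; apply/funext => v; congr ((_ ^+ 2)%:E).
  by rewrite big_ord_recl consv0 addrA; under eq_bigr do rewrite consv_lift.
rewrite (expectD hE).
- rewrite (expect_cst hE)// EFinD leeD2r//; exact: stdnormalE_sqr_affine.
- by move=> z; rewrite lee_fin sqr_ge0.
- by move=> z; rewrite lee_fin.
- move=> dd S u mu_; apply/measurable_EFinP; apply: measurable_funX.
  by apply: measurable_funD => //; exact: measurable_funM.
- by move=> dd S u _; exact: measurable_cst.
Qed.

End ProductExpectation.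

(** * Multivariate normal rows *)

Section MultivariateNormal.
Context {R : realType}.

Lemma iid_lebE_ge0 N (f : ('I_N -> R) -> \bar R) : (forall v, 0 <= f v)%E ->
  (0 <= iidE 0%R (@lebE R) f)%E.
Proof.
elim: N f => [|N IH] f f0; first exact: f0.
by rewrite iidES; apply: lebE_ge0 => x; apply: IH.
Qed.

Lemma iid_lebEZ N (k : R) (f : ('I_N -> R) -> \bar R) : 0 <= k ->
  (forall v, 0 <= f v)%E ->
  (iidE 0%R (@lebE R) (fun v => k%:E * f v) = k%:E * iidE 0%R (@lebE R) f)%E.
Proof.
move=> k0; elim: N f => [//|N IH] f f0.
rewrite !iidES -lebEZ// => [|x]; last exact: iid_lebE_ge0.
by congr lebE; apply/funext => x; rewrite IH.
Qed.

Lemma iid_lebE_normal N (h : ('I_N -> R) -> \bar R) : (forall v, 0 <= h v)%E ->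
  iidE 0%R (@lebE R) (fun y => (\prod_i std_normal_pdf (y i))%:E * h y)%E =
  iidE 0%R (@stdnormalE R) h.
Proof.
elim: N h => [|N IH] h h0; first by rewrite /= big_ord0 mul1e.
rewrite !iidES; congr lebE; apply/funext => x; rewrite -IH//.
rewrite -iid_lebEZ ?std_normal_pdf_ge0//; last first.
  by move=> v; rewrite mule_ge0// lee_fin prodr_ge0// => i _; exact: std_normal_pdf_ge0.
congr iidE; apply/funext => v; rewrite muleA -EFinM big_ord_recl consv0.
by congr ((_ * _)%:E * _)%E; apply: eq_bigr => i _; rewrite consv_lift.
Qed.

Definition posdefmx p (S : 'M[R]_p) :=
  S^T = S /\ forall u : 'rV_p, u != 0 -> 0 < (u *m S *m u^T) 0 0.

Lemma row_consv N (x : R) (v : 'I_N -> R) :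
  \row_i consv x v i = row_mx x%:M (\row_i v i) :> 'rV_(1 + N).
Proof.
apply/rowP => i; rewrite [LHS]mxE; case: (unliftP (ord0 : 'I_N.+1) i) => [j|] ->.
  rewrite consv_lift (_ : lift ord0 j = rshift 1 j); last exact/val_inj.
  by rewrite row_mxEr mxE.
rewrite consv0 (_ : @ord0 N = lshift N (@ord0 0)); last exact/val_inj.
by rewrite row_mxEl mxE.
Qed.

(* Block Cholesky: [L] is lower triangular, so substituting [x = y L^T] only
   requires one-dimensional affine substitutions, one coordinate at a time. *)
Lemma cholesky_substitution p (S : 'M[R]_p) : posdefmx S ->
  exists L : 'M[R]_p, [/\ S = L *m L^T, 0 < \det L &
    forall (c : 'rV_p) (g : 'rV_p -> \bar R), (forall x, 0 <= g x)%E ->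
      iidE 0%R (@lebE R) (fun x => g (\row_i x i)) =
      ((\det L)%:E * iidE 0%R (@lebE R) (fun y => g ((\row_i y i) *m L^T + c)%R))%E].
Proof.
elim: p S => [|p IH] S [Ssym Spos].
  exists 1%:M; split; first by rewrite [LHS]flatmx0 [RHS]flatmx0.
    by rewrite det1.
  move=> c g g0; rewrite det1 mul1e /=; congr g; by rewrite [LHS]thinmx0 [RHS]thinmx0.
pose S1 : 'M[R]_(1 + p) := S.
pose s := S1 0 0; pose b := dlsubmx S1; pose D := drsubmx S1.
have Sblock : S1 = block_mx s%:M b^T b D.
  rewrite -[LHS]submxK; congr block_mx.
    by apply/matrixP => i j; rewrite !ord1 !mxE/= mulr1n; congr (S1 _ _); exact/val_inj.
  by rewrite /b trmx_dlsub; congr ursubmx; exact: esym Ssym.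
have Dsym : D^T = D by rewrite /D trmx_drsub; congr drsubmx; exact: Ssym.
have quad (x : R) (u : 'rV_p) :
    (row_mx x%:M u *m S1 *m (row_mx x%:M u)^T) 0 0 =
    x ^+ 2 * s + 2 * x * (u *m b) 0 0 + (u *m D *m u^T) 0 0.
  rewrite Sblock mul_row_block tr_row_mx mul_row_col tr_scalar_mx.
  rewrite !mulmxDl !mul_scalar_mx !mul_mx_scalar -!scalemxAl.
  have -> : b^T *m u^T = u *m b.
    by rewrite -trmx_mul; apply/matrixP => i j; rewrite !ord1 mxE.
  by rewrite !mxE/= mulr1n; ring.
have s0 : 0 < s.
  have w0 : row_mx 1%:M (0 : 'rV[R]_p) != 0 :> 'rV_(1 + p).
    apply/eqP => /matrixP /(_ 0 (lshift p 0)); rewrite row_mxEl !mxE/= => /eqP.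
    by rewrite oner_eq0.
  have := Spos _ w0; rewrite -[S]/S1 (quad 1 0) !mul0mx !mxE.
  by rewrite expr1n mul1r mulr0 !addr0.
have [|L [SL detL subL]] := IH (D - s^-1 *: (b *m b^T)).
  split.
    by rewrite linearB/= linearZ/= trmx_mul trmxK Dsym.
  (* The Schur complement is positive because it is the minimum of the quadratic form over the first
     coordinate; this [x] is the minimiser. *)
  move=> u u0; pose x := - (s^-1 * (u *m b) 0 0).
  have w0 : row_mx x%:M u != 0 :> 'rV_(1 + p).
    by apply: contra_neq u0 => /(congr1 rsubmx); rewrite row_mxKr linear0.
  have := Spos _ w0; rewrite -[S]/S1 (quad x u); congr (0 < _).
  rewrite mulmxBr mulmxBl -scalemxAr -scalemxAl mulmxA.
  have -> : u *m b *m b^T *m u^T = (u *m b) *m (u *m b)^T.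
    by rewrite trmx_mul mulmxA.
  have entry (A w : 'M[R]_1) :
      (A - s^-1 *: (w *m w^T)) 0 0 = A 0 0 - s^-1 * w 0 0 ^+ 2.
    by rewrite !mxE big_ord1 !mxE expr2.
  rewrite entry /x; move: ((u *m b) 0 0) => t.
  by field; rewrite gt_eqF.
pose q := Num.sqrt s; have q0 : 0 < q by rewrite sqrtr_gt0.
have qq : q * q = s by rewrite -expr2 sqr_sqrtr// ltW.
pose L1 : 'M[R]_(1 + p) := block_mx q%:M 0 (q^-1 *: b) L.
have detL1 : \det L1 = q * \det L by rewrite det_lblock det_scalar1.
have SL1 : S1 = L1 *m L1^T.
  rewrite Sblock /L1 tr_block_mx mulmx_block tr_scalar_mx trmx0.
  rewrite !mul0mx !mulmx0 !addr0 -scalar_mxM qq linearZ/= !mul_mx_scalar.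
  rewrite mul_scalar_mx !scalerA mulfV ?gt_eqF// !scale1r -SL.
  rewrite -scalemxAl -scalemxAr scalerA -invfM qq.
  by rewrite addrC subrK.
exists L1; split; [exact: SL1 | by rewrite detL1 mulr_gt0 |].
move=> c g g0; rewrite detL1.
pose H x := iidE 0%R (@lebE R) (fun v : 'I_p -> R => g (row_mx x%:M (\row_i v i))).
have H0 x : (0 <= H x)%E by apply: iid_lebE_ge0.
pose c0 := lsubmx (c : 'rV_(1 + p)) 0 0; pose c1 := rsubmx (c : 'rV_(1 + p)).
have cE : c = row_mx c0%:M c1 :> 'rV_(1 + p).
  rewrite -[LHS](@hsubmxK _ 1 1 p); congr row_mx; apply/matrixP => i j.
  by rewrite !ord1 [RHS]mxE eqxx.
have subE (y : R) (W : 'rV[R]_p) : (row_mx y%:M W : 'rV_(1 + p)) *m L1^T + row_mx c0%:M c1 =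
    row_mx (q * y + c0)%:M (W *m L^T + (c1 + y *: (q^-1 *: b)^T)).
  rewrite /L1 tr_block_mx mul_row_block tr_scalar_mx trmx0 !mulmx0 addr0.
  rewrite add_row_mx -scalar_mxM -raddfD/= mul_scalar_mx [y * q]mulrC.
  by congr row_mx; rewrite -addrA addrC -addrA.
transitivity (lebE H).
  by rewrite iidES; congr lebE; apply/funext => x; congr iidE; apply/funext => v;
    rewrite row_consv.
have := @lebE_affine R q c0 q H q0 (ltW q0) H0.
rewrite divff ?gt_eqF// mul1e => <-.
rewrite lebEZ// ?ltW// EFinM -muleA; congr (_ * _)%E.
rewrite iidES -lebEZ ?ltW//; last by move=> x; apply: iid_lebE_ge0.
congr lebE; apply/funext => y.
(* Here the translation [c] pays off: once the first coordinate is substituted, the others are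
   shifted by a multiple of the first column of [L1], and the induction hypothesis absorbs that
   shift. *)
rewrite /H (subL (c1 + y *: (q^-1 *: b)^T) (fun v => g (row_mx (q * y + c0)%:M v)))//.
congr (_ * _)%E; congr iidE; apply/funext => v; congr g.
rewrite row_consv cE; exact/esym/subE.
Qed.

(** A Gaussian row is a linear image of independent standard normals. Both the expectation axioms
    and the variance bound for [mvnE] are deduced from this form. *)
Lemma mvnE_cholesky p (S : 'M[R]_p) : posdefmx S ->
  exists2 L : 'M[R]_p, S = L *m L^T &
    forall f : 'rV_p -> \bar R, (forall x, 0 <= f x)%E ->
      mvnE S f = iidE 0%R (@stdnormalE R) (fun y => f ((\row_i y i) *m L^T)).
Proof.
move=> /cholesky_substitution[L [SE detL subL]]; exists L => // f f0.
have pdf0 x : 0 <= mvn_pdf S x by rewrite mulr_ge0 ?expR_ge0// invr_ge0 sqrtr_ge0.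
rewrite /mvnE (subL 0 (fun x => (mvn_pdf S x)%:E * f x)%E); last first.
  by move=> x; rewrite mule_ge0// lee_fin.
rewrite -iid_lebEZ ?ltW//; last by move=> v; rewrite mule_ge0// lee_fin.
rewrite -iid_lebE_normal//; congr iidE; apply/funext => y.
rewrite addr0 muleA -EFinM; congr (_%:E * _)%E.
have Lu : L \in unitmx by rewrite unitmxE unitfE gt_eqF.
have LTu : L^T \in unitmx by rewrite unitmx_tr.
have invS : invmx S = invmx L^T *m invmx L.
  have Su : S \in unitmx by rewrite SE unitmx_mul Lu.
  have SX : S *m (invmx L^T *m invmx L) = 1%:M.
    by rewrite SE mulmxA mulmxK// mulmxV.
  by rewrite -[LHS]mulmx1 -SX mulmxA mulVmx// mul1mx.
rewrite /mvn_pdf invS !mulmxA mulmxK// trmx_mul trmxK !mulmxA mulmxKV//.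
have -> : Num.sqrt ((2 * pi) ^+ p * \det S) = Num.sqrt (2 * pi) ^+ p * \det L.
  rewrite SE det_mulmx det_tr -expr2.
  rewrite sqrtrM ?exprn_ge0 ?mulr_ge0 ?pi_ge0// sqrtr_sqr gtr0_norm//.
  by congr (_ * _); elim: (p) => [|k IH];
    rewrite ?expr0 ?sqrtr1// !exprS sqrtrM ?IH ?mulr_ge0 ?pi_ge0.
rewrite invfM [_ ^- p * _]mulrC !mulrA mulfV ?gt_eqF// mul1r.
rewrite /std_normal_pdf big_split/= -expR_sum div1r mulrC; congr (expR _ * _).
  by rewrite mxE mulr_sumr; apply: eq_bigr => i _; rewrite !mxE; field.
by rewrite prodr_const card_ord exprVn.
Qed.

Definition rv_plots p : plots 'rV[R]_p :=
  fun d S u => forall i, measurable_fun setT (fun s => u s 0 i).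

Lemma rv_is_plots p : is_plots (@rv_plots p).
Proof.
split=> [d S x i|d d' S S' w u mw plu i]; first exact: measurable_cst.
exact: measurableT_comp (plu i) mw.
Qed.

Lemma expectation_eq (T : Type) (pl : plots T) (E E' : (T -> \bar R) -> \bar R) :
  expectation_op pl E -> (forall f, (forall t, 0 <= f t)%E -> E' f = E f) ->
  expectation_op pl E'.
Proof.
move=> hE eE; split.
- exact: expect_plots hE.
- move=> f g f0 fg; rewrite !eE//; first exact: (expect_le hE).
  by move=> t; exact: le_trans (fg t).
- move=> k f k0 f0; rewrite !eE//; first exact: (expectZ hE).
  by move=> t; rewrite mule_ge0.
- by rewrite eE//; exact: expect1 hE.
- move=> f g f0 g0 mf mg; rewrite !eE//; first exact: (expectD hE).
  by move=> t; rewrite adde_ge0.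
- move=> d S f f0 mf; rewrite (_ : (fun s => _) = fun s => E (f s)).
    exact: (expect_measurable hE).
  by apply/funext => s; rewrite eE.
Qed.

Lemma expectation_mvnE p (S : 'M[R]_p) : posdefmx S ->
  expectation_op (@rv_plots p) (mvnE S).
Proof.
move=> /mvnE_cholesky[L _ mvnL].
apply: (@expectation_eq _ _ (fun f => iidE (N := p) 0 (@stdnormalE R)
  (fun y => f ((\row_i y i) *m L^T)))) => //.
apply: (expectation_image (rv_is_plots p) (@expectation_iid_normal R p)).
move=> d T u plu i; under eq_fun do rewrite mxE.
apply: measurable_sum => k; apply: measurable_funM => //.
by under eq_fun do rewrite mxE; exact: plu.
Qed.

Lemma mvnE_sqr p (S : 'M[R]_p) (w : 'rV[R]_p) : posdefmx S ->
  (mvnE S (fun x => ((x *m w^T) 0 0 ^+ 2)%:E) <= ((w *m S *m w^T) 0 0)%:E)%E.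
Proof.
move=> /mvnE_cholesky[L SE ->]; last by move=> x; rewrite lee_fin sqr_ge0.
pose d i := (w *m L) 0 i.
rewrite [leLHS](_ : _ = iidE (N := p) 0%R (@stdnormalE R)
    (fun v => ((0 + \sum_i d i * v i) ^+ 2)%:E)%R).
  apply: le_trans (iid_normal_sqr_affine _ _) _.
  rewrite lee_fin expr0n add0r le_eqVlt; apply/orP; left; apply/eqP.
  rewrite SE mulmxA -mulmxA -trmx_mul mxE; apply: eq_bigr => i _.
  by rewrite [(_ ^T) _ _]mxE expr2.
congr iidE; apply/funext => v; congr (_ ^+ 2)%:E.
rewrite add0r -mulmxA -trmx_mul mxE; apply: eq_bigr => i _.
by rewrite [(_ ^T) _ _]mxE mulrC; congr (_ * _); rewrite mxE.
Qed.

End MultivariateNormal.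

(** * Testing two configurations *)

Section TwoPointBound.
Context {R : realType}.

Lemma expect_iid_sum_le (T : Type) (pl : plots T) (t0 : T)
    (E : (T -> \bar R) -> \bar R) (h : T -> R) (m : R) N :
  expectation_op pl E -> (forall t, 0 <= h t) -> 0 <= m ->
  qmeasurable pl (EFin \o h) -> (E (EFin \o h) <= m%:E)%E ->
  (iidE (N := N) t0 E (fun v => (\sum_i h (v i))%:E) <= (N%:R * m)%:E)%E.
Proof.
move=> hE h0 m0 mh hm; elim: N => [|N IH]; first by rewrite /= big_ord0 mul0r.
have hN := expectation_iidE t0 N hE.
rewrite iidES.
rewrite [leLHS](_ : _ = E (fun x => (h x)%:E +
    iidE (N := N) t0 E (fun v => (\sum_i h (v i))%:E))%E).
  have I0 : (0 <= iidE (N := N) t0 E (fun v => (\sum_i h (v i))%:E))%E.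
    by apply: (expect_ge0 hN) => v; rewrite lee_fin sumr_ge0.
  have Ifin : iidE (N := N) t0 E (fun v => (\sum_i h (v i))%:E) \is a fin_num.
    by rewrite ge0_fin_numE// (le_lt_trans IH)// ltry.
  rewrite -(fineK Ifin) in I0 IH *; set c := fine _ in I0 IH *.
  rewrite (expectD hE).
  - rewrite (expect_cst hE)// -natr1 mulrDl mul1r addrC EFinD.
    exact: leeD.
  - by move=> x; rewrite lee_fin.
  - by [].
  - exact: mh.
  - by move=> d S u _; exact: measurable_cst.
congr E; apply/funext => x; rewrite -(expect_cst hN (h0 x)) -(expectD hN).
- congr iidE; apply/funext => v; rewrite -EFinD big_ord_recl consv0.
  by under eq_bigr do rewrite consv_lift.
- by move=> v; rewrite lee_fin.
- by move=> v; rewrite lee_fin sumr_ge0.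
- by move=> d S u _; exact: measurable_cst.
- move=> d S u plu; apply/measurable_EFinP; apply: measurable_sum => i.
  exact/measurable_EFinP/(mh d S (fun s => u s i))/plu.
Qed.

Lemma posdefmxZ p (c : R) (S : 'M[R]_p) : 0 < c -> posdefmx S -> posdefmx (c *: S).
Proof.
move=> c0 [Ssym Spos]; split; first by rewrite linearZ/= Ssym.
move=> u u0; rewrite -scalemxAr -scalemxAl mxE mulr_gt0//; exact: Spos.
Qed.

(** Here [D] stands for d^2 and [y] for <d, z>. When [D <= s2 (1 + delta)] and [|y| <= M], both
    exponentials are at least [expR kap] and [f0 + f1 >= 1] concludes. Otherwise one of the two
    Markov quotients exceeds 1. Keeping them as summands turns the case distinction into a pointwise
    inequality that can be integrated. *)
Lemma exp_mixture_ge (A0 A1 t D y s2 delta M kap f0 f1 : R) :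
  0 <= t <= 1 -> 0 < s2 -> 0 < delta -> 0 < M -> 0 <= D ->
  0 <= f0 -> 0 <= f1 -> 1 <= f0 + f1 ->
  kap <= A0 - t ^+ 2 * (s2 * (1 + delta)) / 2 - M ->
  kap <= A1 - (1 - t) ^+ 2 * (s2 * (1 + delta)) / 2 - M ->
  expR kap <= expR (A0 - t * y - t ^+ 2 * D / 2) * f0 +
              expR (A1 + (1 - t) * y - (1 - t) ^+ 2 * D / 2) * f1 +
              expR kap * (D / (s2 * (1 + delta)) + y ^+ 2 / M ^+ 2).
Proof.
move=> /andP[t0 t1] s0 dl0 M0 D0 f00 f10 f01 k0 k1.
have S0 : 0 < s2 * (1 + delta) by rewrite mulr_gt0//; lra.
set S := s2 * (1 + delta) in S0 k0 k1 *.
have G0 (x f : R) : 0 <= f -> 0 <= expR x * f by move=> ?; rewrite mulr_ge0 ?expR_ge0.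
have rest : 1 <= D / S + y ^+ 2 / M ^+ 2 -> expR kap <= expR (A0 - t * y - t ^+ 2 * D / 2)
  * f0 +
    expR (A1 + (1 - t) * y - (1 - t) ^+ 2 * D / 2) * f1 +
    expR kap * (D / S + y ^+ 2 / M ^+ 2).
  move=> h; apply: (@le_trans _ _ (expR kap * (D / S + y ^+ 2 / M ^+ 2))).
    by rewrite ler_peMr// expR_ge0.
  by rewrite lerDr addr_ge0// G0.
have y2 : 0 <= y ^+ 2 / M ^+ 2 by rewrite divr_ge0// ?sqr_ge0// exprn_ge0// ltW.
have DS0 : 0 <= D / S by rewrite divr_ge0// ltW.
have [DS|SD] := leP D S; last first.
  by apply: rest; rewrite -[leLHS]addr0 lerD// ler_pdivlMr// mul1r ltW.
have [yM|My] := leP `|y| M; last first.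
  apply: rest; rewrite -[leLHS]add0r lerD// ler_pdivlMr ?exprn_gt0// mul1r.
  by rewrite -(real_normK (num_real y)) lerXn2r ?nnegrE// ltW.
apply: (@le_trans _ _ (expR kap * f0 + expR kap * f1)).
  by rewrite -mulrDr ler_peMr// expR_ge0.
rewrite -[leLHS]addr0 lerD//; last by rewrite mulr_ge0 ?expR_ge0// addr_ge0.
have /andP[yl yu] : - M <= y <= M by rewrite -ler_norml.
have tD : t ^+ 2 * D <= t ^+ 2 * S by rewrite ler_wpM2l// sqr_ge0.
have tD' : (1 - t) ^+ 2 * D <= (1 - t) ^+ 2 * S by rewrite ler_wpM2l// sqr_ge0.
have ty : t * y <= M by nra.
have ty' : - M <= (1 - t) * y by nra.
by rewrite lerD// ler_wpM2r// ler_expR; lra.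
Qed.

Definition data_measurable n p (phi : ('I_n -> R) -> 'M[R]_(n, p) -> R) :=
  forall d (S : measurableType d) (Y : S -> 'I_n -> R) (X : S -> 'M[R]_(n, p)),
    (forall i, measurable_fun setT (fun s => Y s i)) ->
    (forall i k, measurable_fun setT (fun s => X s i k)) ->
    measurable_fun setT (fun s => phi (Y s) (X s)).

Section Design.
Variables (n p : nat) (Om : 'M[R]_p).
Hypotheses (n0 : (0 < n)%N) (hOm : posdefmx Om).

Let posn : posdefmx (n%:R^-1 *: Om).
Proof. by apply: posdefmxZ => //; rewrite invr_gt0 ltr0n. Qed.

Lemma expectation_design :
  expectation_op (prod_plots (iid_plots (@rv_plots R p) (N := n))
                             (iid_plots (@real_plots R) (N := n)))
    (fun f => designE Om (fun X z => f (fun i => row i X, z))).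
Proof.
have hr := expectation_iidE 0 n (expectation_mvnE posn).
apply: expectation_eq (expectation_prod hr (expectation_iid_normal n)) _ => f f0.
rewrite /designE; congr iidE; apply/funext => rows.
congr iidE; apply/funext => z; congr (f (_, _)); apply/funext => i.
by apply/rowP => k; rewrite !mxE.
Qed.

Implicit Types F G : 'M[R]_(n, p) -> ('I_n -> R) -> \bar R.

Let uncurry_rows (F : 'M[R]_(n, p) -> ('I_n -> R) -> \bar R)
    (q : ('I_n -> 'rV[R]_p) * ('I_n -> R)) : \bar R :=
  F (\matrix_(i, k) q.1 i 0 k) q.2.

Let uncurry_rowsE F X z : uncurry_rows F (fun i => row i X, z) = F X z.
Proof. by congr (F _ _); apply/matrixP => i k; rewrite !mxE. Qed.

Let designE_uncurry F :
  designE Om F = designE Om (fun X z => uncurry_rows F (fun i => row i X, z)).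
Proof.
by congr designE; apply/funext => X; apply/funext => z; rewrite uncurry_rowsE.
Qed.

Definition design_measurable (F : 'M[R]_(n, p) -> ('I_n -> R) -> \bar R) :=
  forall d (S : measurableType d) (X : S -> 'M[R]_(n, p)) (z : S -> 'I_n -> R),
    (forall i k, measurable_fun setT (fun s => X s i k)) ->
    (forall i, measurable_fun setT (fun s => z s i)) ->
    measurable_fun setT (fun s => F (X s) (z s)).

Lemma designE_ge0 F : (forall X z, 0 <= F X z)%E -> (0 <= designE Om F)%E.
Proof.
move=> F0; rewrite designE_uncurry; apply: (expect_ge0 expectation_design) => q.
exact: F0.
Qed.

Lemma designE_le F G : (forall X z, 0 <= F X z)%E ->
  (forall X z, F X z <= G X z)%E -> (designE Om F <= designE Om G)%E.
Proof.
move=> F0 FG; rewrite (designE_uncurry F) (designE_uncurry G).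
apply: (expect_le expectation_design) => q; [exact: F0|exact: FG].
Qed.

Lemma designEZ (k : R) F : 0 <= k -> (forall X z, 0 <= F X z)%E ->
  designE Om (fun X z => k%:E * F X z)%E = (k%:E * designE Om F)%E.
Proof.
move=> k0 F0; rewrite (designE_uncurry F) designE_uncurry.
rewrite -(expectZ expectation_design k0)// => q; exact: F0.
Qed.

Lemma designED F G : (forall X z, 0 <= F X z)%E -> (forall X z, 0 <= G X z)%E ->
  design_measurable F -> design_measurable G ->
  designE Om (fun X z => F X z + G X z)%E = (designE Om F + designE Om G)%E.
Proof.
move=> F0 G0 mF mG.
have mU H : design_measurable H -> qmeasurable
    (prod_plots (iid_plots (@rv_plots R p) (N := n))
                (iid_plots (@real_plots R) (N := n))) (uncurry_rows H).
  move=> mH d S u [plX plz]; apply: (mH d S) => [i k|i]; last exact: plz.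
  by under eq_fun do rewrite mxE; exact: plX.
rewrite (designE_uncurry F) (designE_uncurry G) [LHS]designE_uncurry.
rewrite -(expectD expectation_design).
- by [].
- by move=> q; exact: F0.
- by move=> q; exact: G0.
- exact: mU.
- exact: mU.
Qed.

Lemma designE_cst (k : R) : 0 <= k -> designE (n := n) Om (fun _ _ => k%:E) = k%:E.
Proof. exact: (expect_cst expectation_design). Qed.

Lemma eq_designE F G :
  (forall X, iidE 0%R (@stdnormalE R) (F X) = iidE 0%R (@stdnormalE R) (G X)) ->
  designE Om F = designE Om G.
Proof.
by move=> FG; rewrite /designE; congr iidE; apply/funext => rows; exact: FG.
Qed.

Variables (sigma : R) (b0 b1 : 'I_p -> R).
Hypothesis sigma0 : 0 < sigma.
Let w : 'rV[R]_p := \row_k (b1 k - b0 k).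
Let dd (X : 'M[R]_(n, p)) (i : 'I_n) : R := sigma^-1 * \sum_k X i k * w 0 k.
Let nd (X : 'M[R]_(n, p)) : R := \sum_i dd X i ^+ 2.

Variable s2 : R.
Hypotheses (s20 : 0 < s2) (hs2 : (w *m Om *m w^T) 0 0 <= sigma ^+ 2 * s2).

(** Each of the [n] rows contributes at most [w Om w^T / (n sigma^2)], so [n] cancels. *)
Let design_norm_le : (designE Om (fun X _ => (nd X)%:E) <= s2%:E)%E.
Proof.
pose h (x : 'rV[R]_p) : R := sigma ^- 2 * (x *m w^T) 0 0 ^+ 2.
have s'0 : 0 <= sigma ^- 2 by rewrite invr_ge0 sqr_ge0.
have h0 x : 0 <= h x by rewrite mulr_ge0// sqr_ge0.
have w0 : 0 <= (w *m (n%:R^-1 *: Om) *m w^T) 0 0.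
  have [-> | wn0] := eqVneq w 0; first by rewrite !mul0mx mxE.
  by rewrite ltW//; exact: (posn.2 _ wn0).
rewrite /designE.
have hE := expectation_mvnE posn.
rewrite [leLHS](_ : _ = iidE (N := n) 0%R (mvnE (n%:R^-1 *: Om))
    (fun rows => (\sum_i h (rows i))%:E)); last first.
  congr iidE; apply/funext => rows.
  rewrite (expect_cst (expectation_iid_normal n)); last first.
    by apply: sumr_ge0 => i _; exact: sqr_ge0.
  congr EFin; apply: eq_bigr => i _; rewrite /dd /h exprMn exprVn; congr (_ * _ ^+ 2).
  by rewrite mxE; apply: eq_bigr => k _; rewrite !mxE.
apply: (@le_trans _ _ (n%:R * (sigma ^- 2 * (w *m (n%:R^-1 *: Om) *m w^T) 0 0))%:E).
  apply: (expect_iid_sum_le (pl := @rv_plots R p)) => //.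
  - by rewrite mulr_ge0.
  - move=> d S u plu; apply/measurable_EFinP; apply: measurable_funM => //.
    apply: measurable_funX; under eq_fun do rewrite mxE.
    by apply: measurable_sum => k; apply: measurable_funM.
  - rewrite EFinM (_ : EFin \o h = fun x => (sigma ^- 2)%:E * ((x *m w^T) 0 0 ^+ 2)%:E)%E//.
    rewrite (expectZ hE)//; last by move=> x; rewrite lee_fin sqr_ge0.
    by rewrite lee_wpmul2l// ?lee_fin//; exact: mvnE_sqr.
rewrite lee_fin -scalemxAr -scalemxAl mxE mulrCA [n%:R * _]mulrA.
rewrite mulfV ?pnatr_eq0 -?lt0n// mul1r.
by rewrite ler_pdivrMl ?exprn_gt0.
Qed.

(** [A0] and [A1] are log prior weights; [phi0] and [phi1] will be the numbers of sign errors on a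
    block under the two hypotheses. Both shifts lead to the same data [Y X z], so [phi0 + phi1 >= 1]
    can be used pointwise through [exp_mixture_ge]; the Markov quotients are integrated and moved to
    the left. *)
Lemma two_point_bound (phi0 phi1 : ('I_n -> R) -> 'M[R]_(n, p) -> R)
    (A0 A1 t delta M kap : R) :
  (forall Y X, 0 <= phi0 Y X) -> (forall Y X, 0 <= phi1 Y X) ->
  (forall Y X, 1 <= phi0 Y X + phi1 Y X) ->
  data_measurable phi0 -> data_measurable phi1 ->
  0 <= t <= 1 -> 0 < delta -> 0 < M ->
  kap <= A0 - t ^+ 2 * (s2 * (1 + delta)) / 2 - M ->
  kap <= A1 - (1 - t) ^+ 2 * (s2 * (1 + delta)) / 2 - M ->
  ((expR kap * (1 - (1 + delta)^-1 - s2 / M ^+ 2))%:E <=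
   (expR A0)%:E * designE Om (fun X z =>
     (phi0 (fun i => \sum_k X i k * b0 k + sigma * z i) X)%:E) +
   (expR A1)%:E * designE Om (fun X z =>
     (phi1 (fun i => \sum_k X i k * b1 k + sigma * z i) X)%:E))%E.
Proof.
move=> f00 f10 f01 mf0 mf1 t01 dl0 M0 k0 k1.
pose m (X : 'M[R]_(n, p)) i := \sum_k X i k * b0 k + t * sigma * dd X i.
pose ip (X : 'M[R]_(n, p)) (z : 'I_n -> R) := \sum_i dd X i * z i.
pose Y X z i := m X i + sigma * z i.
pose G0 X z := expR (A0 - t * ip X z - t ^+ 2 * nd X / 2) * phi0 (Y X z) X.
pose G1 X z := expR (A1 + (1 - t) * ip X z - (1 - t) ^+ 2 * nd X / 2) * phi1 (Y X z) X.
have nd0 X : 0 <= nd X by apply: sumr_ge0 => i _; exact: sqr_ge0.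
have hz := expectation_iid_normal (R := R) n.
have sdd X i : sigma * dd X i = \sum_k X i k * b1 k - \sum_k X i k * b0 k.
  rewrite /dd mulVKf ?gt_eqF// -sumrB; apply: eq_bigr => k _.
  by rewrite mxE mulrBr.
(* [m X] is the intermediate mean: [c = - t] leads back to the mean for [b0], and [c = 1 - t] to the
   mean for [b1]. *)
have shiftE (c A : R) (phi : ('I_n -> R) -> 'M[R]_(n, p) -> R) X :
    (forall Y X, 0 <= phi Y X) ->
    ((expR A)%:E * iidE (N := n) 0%R (@stdnormalE R)
       (fun z => (phi (fun i => m X i + sigma * (z i + c * dd X i))%R X)%:E) =
     iidE (N := n) 0%R (@stdnormalE R)
       (fun z => (expR (A + c * ip X z - c ^+ 2 * nd X / 2) * phi (Y X z) X)%:E))%E.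
  move=> fge0.
  rewrite (iid_normal_shift (fun i => c * dd X i) (f := fun z => (phi (Y X z) X)%:E));
    last first.
    by move=> v; rewrite lee_fin.
  rewrite -(expectZ hz) ?expR_ge0//; last first.
    by move=> v; rewrite mule_ge0// lee_fin// expR_ge0.
  congr iidE; apply/funext => z; rewrite muleA -!EFinM -expRD; congr (expR _ * _)%:E.
  rewrite -addrA; congr (_ + (_ - _ / _)).
    by rewrite /ip mulr_sumr; apply: eq_bigr => i _; rewrite mulrA.
  by rewrite /nd mulr_sumr; apply: eq_bigr => i _; rewrite exprMn.
have E0 : ((expR A0)%:E * designE Om (fun X z =>
     (phi0 (fun i => \sum_k X i k * b0 k + sigma * z i)%R X)%:E) =
     designE Om (fun X z => (G0 X z)%:E))%E.
  rewrite -designEZ ?expR_ge0//; last by move=> X z; rewrite lee_fin.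
  apply: eq_designE => X; rewrite (expectZ hz) ?expR_ge0//; last first.
    by move=> z; rewrite lee_fin.
  rewrite /G0; under [in RHS]eq_fun do rewrite -mulNr -(sqrrN t).
  rewrite -shiftE//; congr (_ * _)%E; congr iidE; apply/funext => z.
  by congr (phi0 _ _)%:E; apply/funext => i; rewrite /m; ring.
have E1 : ((expR A1)%:E * designE Om (fun X z =>
     (phi1 (fun i => \sum_k X i k * b1 k + sigma * z i)%R X)%:E) =
     designE Om (fun X z => (G1 X z)%:E))%E.
  rewrite -designEZ ?expR_ge0//; last by move=> X z; rewrite lee_fin.
  apply: eq_designE => X; rewrite (expectZ hz) ?expR_ge0//; last first.
    by move=> z; rewrite lee_fin.
  rewrite -shiftE//; congr (_ * _)%E; congr iidE; apply/funext => z.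
  congr (phi1 _ _)%:E; apply/funext => i; rewrite /m.
  have := sdd X i; rewrite mulrDr; move: (\sum_k X i k * b0 k) (\sum_k X i k * b1 k) => u v.
  by move=> h; have -> : v = sigma * dd X i + u by [rewrite h subrK]; ring.
rewrite E0 E1.
have mdd d (S : measurableType d) (X : S -> 'M[R]_(n, p)) i :
    (forall i k, measurable_fun setT (fun s => X s i k)) ->
    measurable_fun setT (fun s => dd (X s) i).
  move=> mX; apply: measurable_funM => //; apply: measurable_sum => k.
  exact: measurable_funM.
have mnd d (S : measurableType d) (X : S -> 'M[R]_(n, p)) :
    (forall i k, measurable_fun setT (fun s => X s i k)) ->
    measurable_fun setT (fun s => nd (X s)).
  by move=> mX; apply: measurable_sum => i; apply: measurable_funX; exact: mdd.
have mip d (S : measurableType d) (X : S -> 'M[R]_(n, p)) (z : S -> 'I_n -> R) :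
    (forall i k, measurable_fun setT (fun s => X s i k)) ->
    (forall i, measurable_fun setT (fun s => z s i)) ->
    measurable_fun setT (fun s => ip (X s) (z s)).
  by move=> mX mz; apply: measurable_sum => i; apply: measurable_funM => //; exact: mdd.
have mG (A c e : R) (phi : ('I_n -> R) -> 'M[R]_(n, p) -> R) : data_measurable phi ->
    design_measurable (fun X z => (expR (A + c * ip X z - e * nd X / 2) * phi (Y X z) X)%:E).
  move=> mphi d S X z mX mz; apply/measurable_EFinP; apply: measurable_funM.
    apply: measurableT_comp => //; apply: measurable_funB.
      apply: measurable_funD => //; apply: measurable_funM => //; exact: mip.
    by apply: measurable_funM => //; apply: measurable_funM => //; exact: mnd.
  apply: mphi => // i; apply: measurable_funD; last exact: measurable_funM.
  apply: measurable_funD; last by apply: measurable_funM => //; exact: mdd.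
  by apply: measurable_sum => k; exact: measurable_funM.
have mG0 : design_measurable (fun X z => (G0 X z)%:E).
  have := mG A0 (- t) (t ^+ 2) _ mf0; congr design_measurable.
  by apply/funext => X; apply/funext => z; rewrite mulNr.
have mG1 : design_measurable (fun X z => (G1 X z)%:E) by exact: mG.
have G00 X z : (0 <= (G0 X z)%:E)%E by rewrite lee_fin mulr_ge0 ?expR_ge0.
have G10 X z : (0 <= (G1 X z)%:E)%E by rewrite lee_fin mulr_ge0 ?expR_ge0.
have S0 : 0 < s2 * (1 + delta) by rewrite mulr_gt0//; lra.
have iS0 : 0 <= (s2 * (1 + delta))^-1 by rewrite invr_ge0 ltW.
have iM0 : 0 <= M ^- 2 by rewrite invr_ge0 sqr_ge0.
have mN : design_measurable (fun X _ => (nd X)%:E).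
  by move=> d S X z mX mz; apply/measurable_EFinP; exact: mnd.
have mI : design_measurable (fun X z => (ip X z ^+ 2)%:E).
  by move=> d S X z mX mz; apply/measurable_EFinP/measurable_funX; exact: mip.
(* Given [X], the second moment of <d, z> is at most d^2, so it inherits the bound [s2]. *)
have dip_le : (designE Om (fun X z => (ip X z ^+ 2)%:E) <= s2%:E)%E.
  apply: le_trans design_norm_le; rewrite /designE.
  have hr := expectation_iidE 0 n (expectation_mvnE posn).
  apply: (expect_le hr) => rows.
    by apply: (expect_ge0 hz) => z; rewrite lee_fin sqr_ge0.
  rewrite (expect_cst hz)//.
  have := iid_normal_sqr_affine 0 (dd (\matrix_(i, k) rows i 0 k)).
  rewrite expr0n add0r; apply: le_trans; rewrite le_eqVlt; apply/orP; left; apply/eqP.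
  by congr iidE; apply/funext => z; rewrite add0r.
pose Q X z := ((s2 * (1 + delta))^-1%:E * (nd X)%:E + (M ^- 2)%:E * (ip X z ^+ 2)%:E)%E.
have Q0 X z : (0 <= Q X z)%E.
  by rewrite adde_ge0// mule_ge0// lee_fin// sqr_ge0.
have mQ : design_measurable Q.
  move=> d S X z mX mz; apply/measurable_EFinP; apply: measurable_funD.
    by apply: measurable_funM => //; exact: mnd.
  by apply: measurable_funM => //; apply: measurable_funX; exact: mip.
have dQ : (designE Om Q <= ((1 + delta)^-1 + s2 / M ^+ 2)%:E)%E.
  rewrite designED; first last.
  - by move=> d S X z mX mz; apply: emeasurable_funM => //; exact: mI.
  - by move=> d S X z mX mz; apply: emeasurable_funM => //; exact: (mN _ _ _ z).
  - by move=> X z; rewrite mule_ge0// lee_fin// sqr_ge0.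
  - by move=> X z; rewrite mule_ge0// lee_fin.
  rewrite EFinD designEZ//; last by move=> X z; rewrite lee_fin.
  rewrite designEZ//; last by move=> X z; rewrite lee_fin sqr_ge0.
  apply: leeD.
    rewrite (_ : (1 + delta)^-1 = (s2 * (1 + delta))^-1 * s2);
      last by rewrite invfM mulrAC mulVf ?mul1r// gt_eqF.
    by rewrite EFinM lee_wpmul2l// lee_fin.
  by rewrite mulrC EFinM lee_wpmul2l// lee_fin.
have main : ((expR kap)%:E <= designE Om (fun X z => (G0 X z)%:E) +
    designE Om (fun X z => (G1 X z)%:E) + (expR kap)%:E * designE Om Q)%E.
  rewrite -(designEZ (expR_ge0 _))// -designED// -designED; first last.
  - by move=> d S X z mX mz; apply: emeasurable_funM => //; exact: mQ.
  - by move=> d S X z mX mz; apply: emeasurable_funD; [exact: mG0|exact: mG1].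
  - by move=> X z; rewrite mule_ge0// lee_fin expR_ge0.
  - by move=> X z; rewrite adde_ge0.
  rewrite -[leLHS](designE_cst (expR_ge0 _)); apply: designE_le => X z.
    by rewrite lee_fin expR_ge0.
  rewrite [leRHS](_ : _ = (G0 X z + G1 X z + expR kap *
    ((s2 * (1 + delta))^-1 * nd X + M ^- 2 * ip X z ^+ 2))%:E)// lee_fin.
  have := @exp_mixture_ge A0 A1 t (nd X) (ip X z) s2 delta M kap
    (phi0 (Y X z) X) (phi1 (Y X z) X).
  by rewrite [nd X / _]mulrC [_ / M ^+ 2]mulrC; apply.
rewrite mulrBr mulrBr mulr1 -addrA -opprD -mulrDr EFinB leeBlDr//.
apply: le_trans main _; rewrite leeD2l// EFinM lee_wpmul2l// lee_fin expR_ge0.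
Qed.
End Design.
End TwoPointBound.

(** * Measurability of sign errors, resampling, independent sets *)

Section Mismatch.
Context {R : realType}.

Lemma borel_fun_comp N (f : ('I_N -> R) -> R) d (S : measurableType d)
    (v : S -> 'I_N -> R) :
  borel_fun f -> (forall i, measurable_fun setT (fun s => v s i)) ->
  measurable_fun setT (fun s => f (v s)).
Proof.
move=> bf mv _ B mB; rewrite setTI.
have : [set A | measurable (v @^-1` A)] (f @^-1` B); last by [].
suff sub : <<s @coord_sets R N >> `<=` [set A | measurable (v @^-1` A)].
  by apply: sub; exact: bf.
apply: smallest_sub.
  split => /=.
  - by rewrite preimage_set0.
  - by move=> A mA; rewrite setTD preimage_setC; exact: measurableC.
  - by move=> F mF; rewrite preimage_bigcup; exact: bigcupT_measurable.
move=> _ [i [C [mC ->]]] /=.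
by rewrite -[X in measurable X]setTI; exact: (mv i measurableT C mC).
Qed.

Definition mismatch n p (est : estimator R n p) (beta : 'I_p -> R) (i : 'I_p)
    (Y : 'I_n -> R) (X : 'M[R]_(n, p)) : R :=
  (Num.sg (est Y X i) != Num.sg (beta i))%:R.

Lemma mismatch_measurable n p (est : estimator R n p) beta i :
  measurable_estimator est -> data_measurable (mismatch est beta i).
Proof.
move=> mest d S Y X mY mX.
(* Measurability of an estimator is stated on flattened data; [v s] flattens [(Y s, X s)]. *)
pose v s (k : 'I_(n + n * p)) : R :=
  match fintype.split k with inl a => Y s a | inr b => mxvec (X s) 0 b end.
have vY s : data_Y (v s) = Y s.
  by apply/funext => a; rewrite /data_Y /v; case: split_ordP => [b|b] /eqP;
    rewrite ?eq_lshift ?eq_lrshift// => /eqP ->.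
have vX s : data_X (v s) = X s.
  apply/matrixP => a k; rewrite mxE /v; case: split_ordP => [b|b] /eqP.
    by rewrite eq_rlshift.
  by rewrite eq_rshift => /eqP <-; rewrite mxvecE.
have mest_i : measurable_fun setT (fun s => est (Y s) (X s) i).
  rewrite (_ : (fun s => _) = (fun s => est (data_Y (v s)) (data_X (v s)) i)).
    apply: (borel_fun_comp (mest i)) => k; rewrite /v.
    case: (fintype.split k) => [a|b]; first exact: mY.
    by case/mxvec_indexP: b => a c; under eq_fun do rewrite mxvecE; exact: mX.
  by apply/funext => s; rewrite vY vX.
rewrite /mismatch.
have mb (b : S -> bool) : measurable_fun setT b -> measurable_fun setT (fun s => (b s)%:R : R).
  move=> mb; rewrite (_ : (fun s => _) = fun s => if b s then 1 else 0).
    exact: measurable_fun_ifT.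
  by apply/funext => s; case: (b s).
apply: mb; apply: measurable_neg.
have [b0|b0|->] := ltgtP (beta i) 0.
- rewrite (ltr0_sg b0) (_ : (fun s => _) = fun s => est (Y s) (X s) i < 0).
    exact: measurable_fun_ltr.
  by apply/funext => s; case: sgrP => //= _; rewrite ?eqxx//; apply/negbTE/eqP; lra.
- rewrite (gtr0_sg b0) (_ : (fun s => _) = fun s => 0 < est (Y s) (X s) i).
    exact: measurable_fun_ltr.
  by apply/funext => s; case: sgrP => //= _; rewrite ?eqxx//; apply/negbTE/eqP; lra.
- rewrite sgr0 (_ : (fun s => _) = fun s => est (Y s) (X s) i == 0).
    exact: measurable_fun_eqr.
  by apply/funext => s; rewrite sgr_eq0.
Qed.

End Mismatch.

Section Combinatorics.
Context {R : realType}.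

(** Under a product law, restricting to a prescribed pattern on [D] amounts to overwriting the
    coordinates in [D] and paying the weight of the pattern. Two different patterns can then be
    compared over the same outside coordinates. *)
Lemma resample (p : nat) (A : finType) (w : A -> R) (D : {set 'I_p}) (v : 'I_p -> A)
    (f : {ffun 'I_p -> A} -> R) : \sum_a w a = 1 ->
  \sum_(x : {ffun 'I_p -> A} | [forall i in D, x i == v i]) (\prod_i w (x i)) * f x =
  \sum_(x : {ffun 'I_p -> A}) (\prod_i w (x i)) *
    ((\prod_(i in D) w (v i)) * f [ffun i => if i \in D then v i else x i]).
Proof.
move=> w1; pose T (x : {ffun 'I_p -> A}) : {ffun 'I_p -> A} :=
  [ffun i => if i \in D then v i else x i].
rewrite [RHS](partition_big T (fun y => [forall i in D, y i == v i]))/=; last first.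
  by move=> x _; apply/forall_inP => i iD; rewrite ffunE iD.
apply: eq_bigr => y /forall_inP yD.
rewrite (eq_bigr (fun x : {ffun 'I_p -> A} => (\prod_i w (x i)) * ((\prod_(i in D) w (v i))
  * f y))); last first.
  by move=> x /eqP <-.
rewrite -mulr_suml mulrA; congr (_ * _).
(* The fibre of the overwriting map is a product set: coordinates in [D] are free and sum to 1, the
   others are fixed. *)
rewrite (eq_bigl (mem (family (fun i : 'I_p => [pred a | (i \in D) || (a == y i)]))));
  last first.
  move=> x; apply/eqP/familyP => [<- i|h].
    by rewrite !inE ffunE; case: (i \in D) => //=.
  apply/ffunP => i; rewrite ffunE; have := h i; rewrite !inE; case: ifP => [iD _|_ /eqP//].
  by rewrite (eqP (yD i iD)).
rewrite -(bigA_distr_big_dep _ (fun i a => w a)) [in LHS](bigID (mem D))/=.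
rewrite [X in _ = X * _](bigID (mem D))/= [X in _ = X * _ * _]big1 ?mul1r; last first.
  by move=> i iD; rewrite -[RHS]w1; apply: eq_bigl => a; rewrite /= iD.
rewrite mulrC; congr (_ * _).
  by apply: eq_bigr => i /negbTE iD; rewrite (eq_bigl (pred1 (y i))) ?big_pred1_eq// => a;
    rewrite /= iD.
by apply: eq_bigr => i iD; rewrite (eqP (yD i iD)).
Qed.

(* Greedy choice: keep the heaviest remaining vertex, discard its neighbours. *)
Lemma independent_set_weight (T : finType) (e : rel T) (d : nat) (w : T -> R) :
  symmetric e -> (forall j, (#|[pred k | (k != j) && e j k]| <= d)%N) ->
  (forall j, 0 <= w j) ->
  forall S : {set T}, exists I : {set T}, [/\ I \subset S,
    {in I &, forall j k, k != j -> ~~ e j k} &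
    \sum_(j in S) w j <= d.+1%:R * \sum_(j in I) w j].
Proof.
move=> esym hd w0 S; move: {2}#|S| (leqnn #|S|) => m.
elim: m S => [|m IH] S Sm.
  exists finset.set0; split; [exact: finset.sub0set|by move=> j k; rewrite inE|].
  by move: Sm; rewrite leqn0 cards_eq0 => /eqP ->; rewrite !big_set0 mulr0.
have [->|[j0 j0S]] := set_0Vmem S.
  by exists finset.set0; split; [exact: finset.sub0set|by move=> j k;
    rewrite inE|rewrite !big_set0 mulr0].
have [j jS jmax] : exists2 j, j \in S & forall k, k \in S -> w k <= w j.
  case: (@arg_maxP _ _ _ j0 (mem S) w j0S) => j jS jmax.
  by exists j => // k kS; exact: jmax.
pose N : {set T} := [set k in S | (k == j) || e j k]%SET.
have NS : N \subset S by apply/fintype.subsetP => k; rewrite inE => /andP[].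
have jN : j \in N by rewrite inE jS eqxx.
have [|I [IS Ind Iw]] := IH (S :\: N)%SET.
  rewrite -ltnS; apply: leq_trans Sm; apply: proper_card; apply/properP; split.
    exact: finset.subsetDl.
  by exists j => //; rewrite inE jN.
have IN k : k \in I -> (k \in S) && ~~ ((k == j) || e j k).
  by move=> /(fintype.subsetP IS); rewrite !inE => /andP[/[swap] ->].
have jI : j \notin I by apply/negP => /IN; rewrite eqxx andbF.
exists (j |: I)%SET; split.
- by rewrite finset.subUset finset.sub1set jS (fintype.subset_trans IS)// finset.subsetDl.
- move=> k l; rewrite !inE => /predU1P[->|kI] /predU1P[->|lI]; rewrite ?eqxx//.
  + by move: (IN l lI); rewrite negb_or => /and3P[].
  + by move: (IN k kI); rewrite negb_or esym => /and3P[].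
  + exact: Ind.
rewrite (big_setID N)/= big_setU1//= mulrDr lerD//.
rewrite (finset.setIidPr NS); apply: (@le_trans _ _ (\sum_(k in N) w j)).
  by apply: ler_sum => k kN; apply: jmax; exact: (fintype.subsetP NS).
(* [N] consists of [j] and at most [d] neighbours, whence the factor [d.+1]. *)
rewrite sumr_const -[leLHS]mulr_natl ler_wpM2r// ler_nat (cardsD1 j) jN ltnS.
apply: leq_trans (hd j); apply: subset_leq_card; apply/fintype.subsetP => k.
by rewrite !inE => /andP[kj /andP[_]]; rewrite kj (negbTE kj).
Qed.

Lemma sum_disjoint_le (T : finType) (I : {set T}) (D : T -> {set T}) (f : T -> R) :
  (forall i, 0 <= f i) ->
  {in I &, forall j k, k != j -> [disjoint D j & D k]%B} ->
  \sum_(j in I) \sum_(i in D j) f i <= \sum_i f i.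
Proof.
move=> f0 dis; rewrite (exchange_big_dep xpredT)//=; apply: ler_sum => i _.
have [j /andP[jI ij]|no] := pickP (fun j => (j \in I) && (i \in D j)).
  rewrite (bigD1 j) ?jI//= big1 ?addr0// => k /andP[/andP[kI ik] kj].
  by have /pred0P/(_ i) := dis j k jI kI kj; rewrite /= ij ik.
by rewrite big_pred0.
Qed.

End Combinatorics.

(** * Least favourable pairs *)

Section Exponents.
Context {R : realType}.

(* The optimal cut between two hypotheses with log-odds gap [|k1 - k0| v] and
   squared separation [2 A]: each side pays at most the exponent of [eta]. *)
Lemma eta_split (v A : R) (k0 k1 : nat) : 0 <= v -> 0 <= A ->
  let e := (maxn k0 k1)%:R * v + (1 / 4) *
    (Num.max (Num.sqrt A - `|k1%:R - k0%:R| * v / Num.sqrt A) 0) ^+ 2 in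
  exists t, [/\ 0 <= t <= 1, k0%:R * v + t ^+ 2 * A <= e &
                k1%:R * v + (1 - t) ^+ 2 * A <= e].
Proof.
wlog k01 : k0 k1 / (k0 <= k1)%N => [hw v0 A0|v0 A0].
  have [k01|] := boolP (k0 <= k1)%N; first by apply: (hw _ _ k01 v0 A0).
  rewrite -ltnNge => /ltnW k10.
  have [t [t01 h0 h1]] := hw _ _ k10 v0 A0.
  exists (1 - t); split; first by lra.
  - by rewrite maxnC distrC.
  - by rewrite maxnC distrC subKr.
have k01R : 0 <= k1%:R - k0%:R :> R by rewrite subr_ge0 ler_nat.
rewrite (maxn_idPr k01) ger0_norm//.
set D := k1%:R - k0%:R in k01R *; set q := Num.sqrt A; move=> e.
have Dv0 : 0 <= D * v by exact: mulr_ge0.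
have kD : k1%:R = k0%:R + D :> R by rewrite /D; ring.
have e0 : k1%:R * v <= e by rewrite /e lerDl mulr_ge0// sqr_ge0.
have [DA|AD] := leP (D * v) A; last first.
  (* The prior gap [D * v] exceeds [A], so carrying the first hypothesis all the way to the second
     mean still costs less than the prior of the second. *)
  exists 1; split; first by lra.
    by rewrite expr1n mul1r; apply: le_trans e0; rewrite kD mulrDl lerD2l ltW.
  by rewrite subrr expr0n mul0r addr0.
have [q0|q0] : 0 < q \/ q = 0.
  by have := sqrtr_ge0 A; rewrite -/q le_eqVlt => /predU1P[qz|]; [right|left].
  2: by have := sqr_sqrtr A0; rewrite -/q q0 expr0n => A00; exists 1; rewrite -A00; split;
     [lra | rewrite mulr0 addr0; apply: le_trans e0;
       rewrite kD mulrDl lerDl | rewrite mulr0 addr0].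
have qA : A = q ^+ 2 by rewrite sqr_sqrtr.
pose x := D * v / q.
have xq : x <= q by rewrite ler_pdivrMr// -expr2 -qA.
have x0 : 0 <= x by rewrite divr_ge0// ltW.
have eE : e = k1%:R * v + (1 / 4) * (q - x) ^+ 2.
  by rewrite /e -/x; congr (_ + _ * _ ^+ 2); apply/max_idPl; rewrite subr_ge0.
have xqD : x * q = D * v by rewrite divfK// gt_eqF.
have k1v : k1%:R * v = k0%:R * v + x * q by rewrite kD mulrDl xqD.
(* This cut equalises the two exponents: the squares of [(q + x) / 2] and [(q - x) / 2] differ by
   [x q], which is the prior gap. *)
exists ((q + x) / (2 * q)); split.
- rewrite divr_ge0 ?ler_pdivrMr ?mulr_gt0//=; try lra.
- rewrite qA eE -exprMn (_ : (q + x) / (2 * q) * q = (q + x) / 2); last by field;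
  rewrite gt_eqF.
  by rewrite k1v; nra.
- rewrite qA eE -exprMn (_ : (1 - (q + x) / (2 * q)) * q = (q - x) / 2); last by field;
  rewrite gt_eqF.
  by nra.
Qed.

(** If [A > 16 B], the prior gap is at most [B < A / 16], so the difference inside the square is at
    least 15/16 of the root of [A], and a quarter of its square already exceeds [B]. *)
Lemma eta_separation_bound (v A B : R) (k0 k1 : nat) : 0 < v -> 0 <= A -> 0 < B ->
  (maxn k0 k1)%:R * v + (1 / 4) *
    (Num.max (Num.sqrt A - `|k1%:R - k0%:R| * v / Num.sqrt A) 0) ^+ 2 <= B ->
  [/\ A <= 16 * B, k0%:R * v <= B & k1%:R * v <= B].
Proof.
move=> v0 A0 B0 hB.
have mB : (maxn k0 k1)%:R * v <= B.
  by apply: le_trans hB; rewrite lerDl mulr_ge0// sqr_ge0.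
have k0B : k0%:R * v <= B.
  by apply: le_trans mB; rewrite (ler_wpM2r (ltW v0))// ler_nat leq_maxl.
have k1B : k1%:R * v <= B.
  by apply: le_trans mB; rewrite (ler_wpM2r (ltW v0))// ler_nat leq_maxr.
split=> //; rewrite leNgt; apply/negP => AB.
have DB : `|k1%:R - k0%:R| * v <= B.
  rewrite -[X in _ * X]gtr0_norm// -normrM mulrBl ler_norml.
  by rewrite lerBlDr lerBrDr; have := ler0n R k0; have := ler0n R k1; nra.
have q0 : 0 < Num.sqrt A by rewrite sqrtr_gt0; lra.
have qA := sqr_sqrtr A0; move: (Num.sqrt A) q0 qA hB => q q0 qA hB.
have xq : `|k1%:R - k0%:R| * v / q <= q / 16.
  rewrite ler_pdivrMr//; nra.
have : (q * (15 / 16)) ^+ 2 <= (Num.max (q - `|k1%:R - k0%:R| * v / q) 0) ^+ 2.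
  rewrite lerXn2r ?nnegrE ?le_max ?lexx ?orbT//; first by rewrite mulr_ge0 ?ltW//; lra.
  by apply/orP; left; lra.
have m0 : 0 <= (maxn k0 k1)%:R * v by rewrite mulr_ge0// ltW.
by rewrite exprMn qA; nra.
Qed.

(** In [s2], [2 l A] is the squared separation and the extra 2 allows for a near-minimiser.
    Expanding [s2 (1 + delta) / 2] exceeds [l A] by at most [(16 B + 2) h^3]; adding [M] gives
    [80 B + 6]. The factor [64 B + 4] makes [s2 / M^2] at most [1 / (4 h^2)], half of the lower
    bound [1 / (2 h^2)] for the probability gained from [delta]. The remaining [1 / (4 h^2)] is
    absorbed by [exp (- 4 h^3)], whence [80 B + 10]. *)
Lemma two_point_constants (l h A e k0 k1 t B : R) : l = h ^+ 4 -> 1 <= h ->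
  0 <= A -> A <= 16 * B -> 0 <= B -> 0 <= t <= 1 ->
  k0 + t ^+ 2 * A <= e -> k1 + (1 - t) ^+ 2 * A <= e ->
  let s2 := 2 * l * A + 2 in let delta := (h ^+ 2)^-1 in
  let M := (64 * B + 4) * h ^+ 3 in let kap := - (e * l) - (80 * B + 6) * h ^+ 3 in
  [/\ kap <= - (k0 * l) - t ^+ 2 * (s2 * (1 + delta)) / 2 - M,
      kap <= - (k1 * l) - (1 - t) ^+ 2 * (s2 * (1 + delta)) / 2 - M &
      expR (- (e * l) - (80 * B + 10) * h ^+ 3) <=
      expR kap * (1 - (1 + delta)^-1 - s2 / M ^+ 2)].
Proof.
move=> -> h1 A0 AB B0 /andP[t0 t1] e0 e1 s2 delta M kap.
have h0 : 0 < h by lra.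
have h2 : 1 <= h ^+ 2 by rewrite exprn_ege1.
have h23 : h ^+ 2 <= h ^+ 3 by rewrite ler_weXn2l.
have hd : h ^+ 4 * delta = h ^+ 2.
  by rewrite /delta (_ : h ^+ 4 = h ^+ 2 * h ^+ 2) ?mulfK ?expf_neq0 ?gt_eqF// -exprD.
have d0 : 0 < delta by rewrite invr_gt0; lra.
have d1 : delta <= 1 by rewrite invf_le1//; lra.
have h40 : 0 < h ^+ 4 by rewrite exprn_gt0.
have slack k (u : R) : 0 <= u <= 1 -> k + u ^+ 2 * A <= e ->
    kap <= - (k * h ^+ 4) - u ^+ 2 * (s2 * (1 + delta)) / 2 - M.
  move=> /andP[u0 u1] ke.
  have u2 : u ^+ 2 <= 1 by rewrite expr_le1.
  have u20 := sqr_ge0 u.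
  have ke' : (k + u ^+ 2 * A) * h ^+ 4 <= e * h ^+ 4 by rewrite ler_wpM2r// ltW.
  have sE : s2 * (1 + delta) / 2 = h ^+ 4 * A + 1 + (A * h ^+ 2 + delta).
    by rewrite -hd /s2; field.
  rewrite -[_ / 2]mulrA sE.
  have Ah : A * h ^+ 2 <= 16 * B * h ^+ 3.
    by rewrite ler_pM// exprn_ge0// ltW.
  have Ah0 : 0 <= A * h ^+ 2 by rewrite mulr_ge0//; lra.
  have : u ^+ 2 * (1 + (A * h ^+ 2 + delta)) <= 1 + (A * h ^+ 2 + delta) by nra.
  rewrite /kap /M; move: (u ^+ 2) u2 u20 ke' => w w1 w0 ke' hw.
  lra.
split; [by apply: slack; rewrite ?t0|by apply: slack => //; lra|].
have Mpos : 0 < M by rewrite mulr_gt0 ?exprn_gt0//; lra.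
have fac : (4 * h ^+ 2)^-1 <= 1 - (1 + delta)^-1 - s2 / M ^+ 2.
  have -> : 1 - (1 + delta)^-1 = (h ^+ 2 + 1)^-1.
    by rewrite /delta; field; rewrite ?gt_eqF//; lra.
  have l1 : 2 * (4 * h ^+ 2)^-1 <= (h ^+ 2 + 1)^-1.
    rewrite (_ : 2 * _ = (2 * h ^+ 2)^-1); last by field; rewrite gt_eqF.
    by rewrite lef_pV2 ?posrE; lra.
  have l2 : s2 / M ^+ 2 <= (4 * h ^+ 2)^-1.
    rewrite ler_pdivrMr ?exprn_gt0// mulrC ler_pdivlMr ?mulr_gt0 ?exprn_gt0//.
    have s2le : s2 <= (32 * B + 2) * h ^+ 4.
      have : h ^+ 4 * A <= h ^+ 4 * (16 * B) by rewrite ler_wpM2l// ltW.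
      have : 1 <= h ^+ 4 by rewrite exprn_ege1.
      rewrite /s2; lra.
    have ME : M ^+ 2 = (32 * B + 2) * (4 * h ^+ 2 * ((32 * B + 2) * h ^+ 4)).
      by rewrite /M; ring.
    apply: (@le_trans _ _ (4 * h ^+ 2 * ((32 * B + 2) * h ^+ 4))).
      by rewrite mulrC ler_wpM2l//; lra.
    rewrite ME ler_peMl//; last by lra.
    by rewrite !mulr_ge0//; lra.
  by lra.
apply: (@le_trans _ _ (expR kap * (4 * h ^+ 2)^-1)); last first.
  by rewrite ler_wpM2l// expR_ge0.
rewrite (_ : - (e * h ^+ 4) - (80 * B + 10) * h ^+ 3 = kap - 4 * h ^+ 3); last first.
  by rewrite /kap; ring.
rewrite expRD ler_wpM2l ?expR_ge0// expRN lef_pV2 ?posrE ?expR_gt0//; last by lra.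
by apply: le_trans (expR_ge1Dx _); lra.
Qed.

(** * Bounds for a single pair of supports *)

Section Pair.
Variables (vt r a sigma : R) (p : nat) (Om : 'M[R]_p).
Hypotheses (vt0 : 0 < vt) (r0 : 0 < r) (a1 : 1 <= a) (sigma0 : 0 < sigma).
Hypothesis hOm : correlation_matrix Om.
Let l := ln (p%:R : R).
Hypothesis l0 : 0 < l.
Variable tau : R.
Hypothesis tauE : tau = tau_p sigma r p.
Let B := vt + r / 4.

Lemma correlation_posdef : posdefmx Om.
Proof. by case: hOm => h1 [_ h2]. Qed.

Let tau0 : 0 < tau.
Proof. by rewrite tauE mulr_gt0// sqrtr_gt0 !mulr_gt0. Qed.

Let tau2 : tau ^+ 2 = sigma ^+ 2 * (2 * r * l).
Proof. by rewrite tauE exprMn sqr_sqrtr// !mulr_ge0// ltW. Qed.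

Let quad_ge0 (u : 'rV[R]_p) : 0 <= (u *m Om *m u^T) 0 0.
Proof.
have [->|u0] := eqVneq u 0; first by rewrite !mul0mx mxE.
by rewrite ltW//; exact: (correlation_posdef.2 _ u0).
Qed.

Let alpha_set (V0 V1 : {set 'I_p}) : set R :=
  [set alpha_fn tau Om t.1 t.2 | t in
        [set t : 'rV[R]_p * 'rV[R]_p | B_set tau a V0 t.1 /\ B_set tau a V1 t.2 /\
                                        map_mx Num.sg t.1 != map_mx Num.sg t.2]].

Let alpha_lb V0 V1 : lbound (alpha_set V0 V1) 0.
Proof. by move=> _ [t _ <-]; rewrite mulr_ge0// invr_ge0 sqr_ge0. Qed.

Let Theta_cst (c : R) : `|c| = tau -> @Theta R p tau a (fun _ => c).
Proof. by move=> ct i; rewrite ct lexx/= ler_peMl// ltW. Qed.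

Let alpha_has_inf V0 V1 j : j \in (V0 :|: V1)%SET -> has_inf (alpha_set V0 V1).
Proof.
move=> jV; split; last by exists 0; exact: alpha_lb.
(* Opposite constant amplitudes have different signs at every point of the union. *)
pose th (V : {set 'I_p}) c : 'rV[R]_p := \row_i ((i \in V)%:R * c).
exists (alpha_fn tau Om (th V0 tau) (th V1 (- tau))), (th V0 tau, th V1 (- tau)) => //=.
split; first by exists (fun _ => tau) => //; apply: Theta_cst; rewrite gtr0_norm.
split.
  by exists (fun _ => - tau) => //; apply: Theta_cst; rewrite normrN gtr0_norm.
apply/eqP => /rowP/(_ j); rewrite !mxE !sgrM sgrN (gtr0_sg tau0).
move: jV; rewrite finset.in_setU; case: (j \in V0); case: (j \in V1) => //= _;
  rewrite ?(mulr1n, mulr0n, sgr1, sgr0, mulr1, mul1r, mul0r) => h; lra.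
Qed.

Lemma alpha_star_ge0 V0 V1 : 0 <= alpha_star tau a Om V0 V1.
Proof.
rewrite /alpha_star -/(alpha_set V0 V1).
have [ne|e] := pselect (alpha_set V0 V1 !=set0).
  by apply: lb_le_inf => //; exact: alpha_lb.
(* The set is empty when both supports are; the infimum is then 0 by convention. *)
by rewrite (_ : alpha_set _ _ = set0) ?inf0//; apply/eqP; apply: contra_notT e => /set0P.
Qed.

Let eta_ge0 (V0 V1 : {set 'I_p}) : 0 <= Defs.eta vt r tau a Om V0 V1.
Proof.
by rewrite addr_ge0// mulr_ge0 ?sqr_ge0// ?ltW// divr_ge0.
Qed.

(* Compare [V0 = set0] with [V1 = [set j]]. *)
Lemma rho_star_le j : rho_star vt r tau a Om j <= B.
Proof.
pose S0 : {set 'I_p} := finset.set0; pose S1 : {set 'I_p} := [set j]%SET.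
apply: (@le_trans _ _ (Defs.eta vt r tau a Om S0 S1)).
  apply: ge_inf; first by exists 0 => _ [V _ <-]; exact: eta_ge0.
  by exists (S0, S1) => //=; rewrite finset.in_setU finset.in_set1 eqxx orbT.
rewrite /Defs.eta cards0 cards1 max0n mul1r subr0 normr1 mul1r lerD2l.
set al := alpha_star _ _ _ _ _.
have al0 : 0 <= al by exact: alpha_star_ge0.
have al1 : al <= 1.
  apply: ge_inf; first by exists 0; exact: alpha_lb.
  exists (0, \row_i ((i \in S1)%:R * tau)); last first.
    rewrite /alpha_fn/= sub0r linearN/= mulmxN !mulNmx opprK.
    have -> : \row_i ((i \in S1)%:R * tau) = tau *: delta_mx 0 j :> 'rV[R]_p.
      by apply/rowP => i; rewrite !mxE eqxx finset.in_set1 /= mulrC.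
    rewrite linearZ/= -scalemxAr -!scalemxAl -rowE trmx_delta -colE !mxE.
    rewrite (hOm.2.1 j) mulr1 -expr2 mulVf// expf_neq0// gt_eqF//.
  split; [|split] => /=.
  - exists (fun _ => tau); first by apply: Theta_cst; rewrite gtr0_norm.
    by apply/rowP => i; rewrite !mxE finset.in_set0 mul0r.
  - by exists (fun _ => tau) => //; apply: Theta_cst; rewrite gtr0_norm.
  - apply/eqP => /rowP/(_ j); rewrite !mxE finset.in_set1 eqxx mul1r sgr0 gtr0_sg//.
    by move=> h; have := oner_neq0 R; rewrite -h eqxx.
have alr0 : 0 <= al * r by rewrite mulr_ge0// ltW.
have alr : al * r <= r by rewrite ler_piMl// ltW.
have x0 : 0 <= vt / Num.sqrt (al * r) by rewrite divr_ge0// ?sqrtr_ge0// ltW.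
rewrite mulrC ler_pM2r ?invr_gt0//.
apply: le_trans alr; rewrite -[leRHS](sqr_sqrtr alr0).
rewrite lerXn2r ?nnegrE ?le_max ?lexx ?orbT ?sqrtr_ge0//.
by rewrite ge_max sqrtr_ge0 andbT lerBlDr lerDl.
Qed.

(** The amplitudes are chosen before [b], which is constrained on the block and otherwise only has
    to agree under both hypotheses. This uniformity lets the other blocks and coins be random. The
    separation depends on the block alone, since the common part cancels in the difference. *)
Lemma pair_bound n (est : estimator R n p) (V0 V1 : {set 'I_p}) j h :
  (0 < n)%N -> measurable_estimator est -> j \in (V0 :|: V1)%SET ->
  Defs.eta vt r tau a Om V0 V1 <= B -> 1 <= h -> l = h ^+ 4 ->
  exists mu : bool -> 'I_p -> R, (forall c, Theta tau a (mu c)) /\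
    forall b : bool -> 'I_p -> R,
    (forall c i, i \in (V0 :|: V1)%SET ->
       b c i = (i \in if c then V1 else V0)%:R * mu c i) ->
    (forall i, i \notin (V0 :|: V1)%SET -> b false i = b true i) ->
    let risk c := designE (n := n) Om (fun X z => (\sum_(i in (V0 :|: V1)%SET)
      mismatch est (b c) i (fun i => \sum_k X i k * b c k + sigma * z i) X)%:E) in
    ((expR (- (Defs.eta vt r tau a Om V0 V1 * l) - (80 * B + 10) * h ^+ 3))%:E <=
      (expR (- (#|V0|%:R * vt * l)))%:E * risk false +
      (expR (- (#|V1|%:R * vt * l)))%:E * risk true)%E.
Proof.
move=> n0 mest jV etaB h1 lh.
have rl0 : 0 < r * l by rewrite mulr_gt0.
have B0 : 0 < B by rewrite addr_gt0// divr_gt0.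
pose al := alpha_star tau a Om V0 V1.
have al0 : 0 <= al by exact: alpha_star_ge0.
have A0 : 0 <= al * r by rewrite mulr_ge0// ltW.
have irl0 : 0 < (r * l)^-1 by rewrite invr_gt0.
(* A pair within [1 / (r l)] of the infimum; multiplied by [2 r l], this tolerance is the extra 2 in
   the squared separation. *)
have [_ [[th0 th1]/= [[mu0 Th0 <-] [[mu1 Th1 <-] sgn]] <-] alle] :=
  inf_adherent irl0 (alpha_has_inf jV).
exists (fun c => if c then mu1 else mu0); split; first by case.
move=> b bD bN.
have [t [t01 te0 te1]] := eta_split #|V0| #|V1| (ltW vt0) A0.
have [AB _ _] := eta_separation_bound vt0 A0 B0 etaB.
have [k0 k1 fin] := two_point_constants lh h1 A0 AB (ltW B0) t01 te0 te1.
have h0 : 0 < h by lra.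
move: fin; rewrite -lee_fin => /le_trans; apply.
have s20 : 0 < 2 * l * (al * r) + 2.
  by have : 0 <= l * (al * r) by [rewrite mulr_ge0// ltW]; lra.
pose w : 'rV[R]_p := \row_k (b true k - b false k).
have wE : w = - (\row_i ((i \in V0)%:R * mu0 i) - \row_i ((i \in V1)%:R * mu1 i)).
  apply/rowP => i; rewrite !mxE opprB.
  have [iV|iV] := boolP (i \in (V0 :|: V1)%SET).
    by rewrite (bD true i iV) (bD false i iV).
  rewrite bN// subrr; move: iV; rewrite finset.in_setU negb_or => /andP[/negbTE -> /negbTE ->].
  by rewrite !mul0r subrr.
have hs2 : (w *m Om *m w^T) 0 0 <= sigma ^+ 2 * (2 * l * (al * r) + 2).
  rewrite wE linearN/= mulmxN !mulNmx opprK.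
  move: alle; rewrite /alpha_fn/= mulrC ltr_pdivrMr ?exprn_gt0// => /ltW/le_trans; apply.
  rewrite -/al tau2 le_eqVlt; apply/orP; left; apply/eqP.
  by field; rewrite !gt_eqF.
have mm0 c i Y X : 0 <= mismatch est (b c) i Y X by rewrite /mismatch ler0n.
have mphi c : data_measurable (fun Y X => \sum_(i in (V0 :|: V1)%SET) mismatch est (b c) i Y X).
  move=> d S Y X mY mX; under eq_fun do rewrite big_mkcond.
  apply: measurable_sum => i; case: (i \in _); last exact: measurable_cst.
  exact: (@mismatch_measurable _ _ _ est (b c) i mest d S Y X).
apply: (two_point_bound n0 correlation_posdef sigma0 s20 hs2 _ _ _ (mphi false) (mphi true)
  t01 _ _ k0 k1).
- by move=> Y X; apply: sumr_ge0.
- by move=> Y X; apply: sumr_ge0.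
- move=> Y X.
  (* Off the union both vectors vanish, so their signs differ inside it, and there no estimate can
     match both. *)
  have [i iV ne] : exists2 i, i \in (V0 :|: V1)%SET & Num.sg (b false i) != Num.sg (b true i).
    have [i /andP[iV ne]|no] := pickP (fun i => (i \in (V0 :|: V1)%SET) && (Num.sg (b false
      i) != Num.sg (b true i))).
      by exists i.
    case/eqP: sgn; apply/rowP => i; rewrite !mxE.
    have [iV|iV] := boolP (i \in (V0 :|: V1)%SET).
      have := no i; rewrite iV/= => /negbFE/eqP.
      by rewrite (bD true i iV) (bD false i iV).
    by move: iV; rewrite finset.in_setU negb_or => /andP[/negbTE -> /negbTE ->]; rewrite !mul0r.
  rewrite -big_split (bigD1 i)//= -[leLHS]addr0 lerD//; last first.
    by apply: sumr_ge0 => k _; exact: addr_ge0.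
  rewrite /mismatch -natrD ler1n.
  by case: eqP => [->|//]; rewrite ne.
- by rewrite invr_gt0 exprn_gt0.
- by rewrite mulr_gt0 ?exprn_gt0//; lra.
Qed.

End Pair.
End Exponents.

(** * Hamming risk over an independent set *)

Section RiskLowerBound.
Context {R : realType}.
Variables (vt r a sigma : R) (p n : nat) (Om : 'M[R]_p).
Hypotheses (vt0 : 0 < vt) (r0 : 0 < r) (a1 : 1 <= a) (sigma0 : 0 < sigma).
Hypothesis hOm : correlation_matrix Om.
Hypothesis n0 : (0 < n)%N.
Let l := ln (p%:R : R).
Hypothesis l0 : 0 < l.
Variable tau : R.
Hypothesis tauE : tau = tau_p sigma r p.
Variable est : estimator R n p.
Hypothesis mest : measurable_estimator est.
Variable eps : R.
Hypotheses (epsE : eps = expR (- (vt * l))) (eps_half : eps <= 1 / 2).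

Let posOm : posdefmx Om := correlation_posdef hOm.

Let mism (beta : 'I_p -> R) i (X : 'M[R]_(n, p)) (z : 'I_n -> R) : R :=
  mismatch est beta i (fun k => \sum_m X k m * beta m + sigma * z k) X.

Let mism_ge0 beta i X z : 0 <= mism beta i X z.
Proof. by rewrite /mism /mismatch ler0n. Qed.

Let mism_measurable beta i : design_measurable (fun X z => (mism beta i X z)%:E).
Proof.
move=> d S X z mX mz; apply/measurable_EFinP.
apply: (@mismatch_measurable _ _ _ est beta i mest d S
  (fun s k => \sum_m X s k m * beta m + sigma * z s k) X) => // k.
apply: measurable_funD; last exact: measurable_funM.
by apply: measurable_sum => m; exact: measurable_funM.
Qed.

Let sum_measurable (I : finType) (P : pred I) (F : I -> 'M[R]_(n, p) -> ('I_n -> R) -> R) :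
  (forall i, design_measurable (fun X z => (F i X z)%:E)) ->
  design_measurable (fun X z => (\sum_(i | P i) F i X z)%:E).
Proof.
move=> mF d S X z mX mz; apply/measurable_EFinP; under eq_fun do rewrite big_mkcond.
apply: measurable_sum => i; case: (P i); last exact: measurable_cst.
by apply/measurable_EFinP; exact: mF.
Qed.

Let designE_sum (I : finType) (P : pred I) (F : I -> 'M[R]_(n, p) -> ('I_n -> R) -> R) :
  (forall i X z, 0 <= F i X z) ->
  (forall i, design_measurable (fun X z => (F i X z)%:E)) ->
  (designE Om (fun X z => (\sum_(i | P i) F i X z)%:E) =
   \sum_(i | P i) designE Om (fun X z => (F i X z)%:E))%E.
Proof.
move=> F0 mF; elim: (index_enum I) => [|i s IH].
  rewrite big_nil -[RHS](designE_cst n0 posOm (lexx 0)).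
  by congr designE; apply/funext => X; apply/funext => z; rewrite big_nil.
have mS : design_measurable (fun X z => (\sum_(i <- s | P i) F i X z)%:E).
  move=> d S X z mX mz; apply/measurable_EFinP; under eq_fun do rewrite big_mkcond.
  apply: measurable_sum => k; case: (P k); last exact: measurable_cst.
  by apply/measurable_EFinP; exact: mF.
rewrite big_cons; case: ifP => Pi; last first.
  by rewrite -IH; congr designE; apply/funext => X; apply/funext => z; rewrite big_cons Pi.
rewrite -IH -(designED n0 posOm)//.
- by congr designE; apply/funext => X; apply/funext => z; rewrite big_cons Pi EFinD.
- by move=> X z; rewrite lee_fin.
- by move=> X z; rewrite lee_fin sumr_ge0.
Qed.

Let block_risk (D : {set 'I_p}) (beta : 'I_p -> R) : \bar R :=
  designE Om (fun X z => (\sum_(i in D) mism beta i X z)%:E).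

Let block_risk_ge0 D beta : (0 <= block_risk D beta)%E.
Proof. by apply: (designE_ge0 n0 posOm) => X z; rewrite lee_fin sumr_ge0. Qed.

Let block_risk_fin D beta : block_risk D beta \is a fin_num.
Proof.
rewrite ge0_fin_numE//; apply: (@le_lt_trans _ _ (#|D|%:R)%:E); last exact: ltry.
rewrite -(designE_cst n0 posOm (ler0n _ #|D|)).
apply: (designE_le n0 posOm) => X z; first by rewrite lee_fin sumr_ge0.
rewrite lee_fin -sumr_const; apply: ler_sum => i _.
by rewrite /mism /mismatch lern1 leq_b1.
Qed.

Variables (V : 'I_p -> {set 'I_p} * {set 'I_p}) (I : {set 'I_p}) (K : nat) (h : R).
Let D j : {set 'I_p} := ((V j).1 :|: (V j).2)%SET.
Let B := vt + r / 4.
Hypotheses (VD : forall j, j \in D j) (h1 : 1 <= h) (lh : l = h ^+ 4).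
Hypothesis VB : forall j, Defs.eta vt r tau a Om (V j).1 (V j).2 <= B.
Hypothesis DK : forall j, (#|D j| <= K)%N.
Hypothesis Idis : {in I &, forall j k, k != j -> [disjoint D j & D k]%B}.

Let Iuniq i j k : j \in I -> k \in I -> i \in D j -> i \in D k -> k = j.
Proof.
move=> jI kI ij ik; apply/eqP; apply/negPn/negP => /(Idis jI kI)/pred0P/(_ i).
by rewrite /= ij ik.
Qed.

(** The joint law of a Bernoulli variable and an independent fair coin. Every coordinate carries a
    coin, which keeps the law a product; only the coins in [I] are read. *)
Let w (x : bool * bool) : R := (if x.1 then eps else 1 - eps) / 2.

Let eps0 : 0 < eps. Proof. by rewrite epsE expR_gt0. Qed.

Let w_ge0 x : 0 <= w x.
Proof. by rewrite /w; case: ifP => _; have := eps_half; have := eps0; lra. Qed.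

Let w_sum : \sum_x w x = 1.
Proof.
rewrite -(pair_bigA _ (fun x y => w (x, y)))/= big_bool !big_bool /w/=; lra.
Qed.

Let W (x : {ffun 'I_p -> bool * bool}) : R := \prod_i w (x i).

Let W_ge0 x : 0 <= W x. Proof. by apply: prodr_ge0. Qed.

Let W_sum : \sum_x W x = 1.
Proof.
rewrite /W -(bigA_distr_bigA (fun i a => w a)) big1// => i _; exact: w_sum.
Qed.

(* [(x i).1] is the Bernoulli variable [b_i]; [(x j).2] selects, for [j] in [I],
   which of the two least favourable amplitude vectors is used on [D j]. *)
Let pattern j (c : bool) (i : 'I_p) : bool * bool :=
  (i \in (if c then (V j).2 else (V j).1), (i == j) && c).

(** Each coordinate of the block pays 1/2 for its coin and, off the support, at most another factor
    1/2 for [1 - eps]; hence [4 ^+ K] for all blocks alike. *)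
Let pattern_weight j c :
  (4 ^+ K)^-1 * expR (- (#|if c then (V j).2 else (V j).1|%:R * vt * l)) <=
  \prod_(i in D j) w (pattern j c i).
Proof.
set U := if c then _ else _.
have UD : U \subset D j by rewrite /U; case: (c);
  [exact: finset.subsetUr|exact: finset.subsetUl].
apply: (@le_trans _ _ (\prod_(i in D j) (4^-1 * (if i \in U then eps else 1)))).
  rewrite big_split/= prodr_const -big_mkcondr/=.
  rewrite (eq_bigl (mem U)) => [|i]; last first.
    by rewrite /=; case iU: (i \in U); rewrite ?andbF// (fintype.subsetP UD).
  rewrite prodr_const epsE -expRM_natl -exprVn.
  rewrite mulrN mulrA.
  rewrite ler_wpM2r ?expR_ge0//.
  by apply: ler_wiXn2l => //; rewrite ?invr_ge0// invf_le1//; lra.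
apply: ler_prod => i _; rewrite /w /pattern /= -/U.
by have := eps_half; have := eps0; case: ifP => _ e0 e1; apply/andP; split; lra.
Qed.

(** For each [j] the two patterns on [D j] are resampled with the outside coordinates unchanged,
    which brings [pair_bound] under the sum. Block risks are then added, and some coin vector does
    at least as well as the average. *)
Lemma hamming_risk_lower : exists2 mu, @Theta R p tau a mu &
  ((\sum_(j in I) (4 ^+ K)^-1 * expR (- (Defs.eta vt r tau a Om (V j).1 (V j).2 * l)
      - (80 * B + 10) * h ^+ 3))%:E <= Hamming_risk sigma est eps mu Om)%E.
Proof.
have /choice[amp ampP] := fun j => @pair_bound R vt r a sigma p Om vt0 r0 a1 sigma0
  hOm l0 tau tauE n est (V j).1 (V j).2 j h n0 mest (VD j) (VB j) h1 lh.
pose muc (c : 'I_p -> bool) (i : 'I_p) : R :=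
  if [pick j | (j \in I) && (i \in D j)] is Some j then amp j (c j) i else tau.
have tau0 : 0 < tau by rewrite tauE mulr_gt0// sqrtr_gt0 !mulr_gt0.
have mucT c : @Theta R p tau a (muc c).
  move=> i; rewrite /muc; case: pickP => [j _|_]; first exact: (ampP j).1.
  by rewrite gtr0_norm// lexx ler_peMl// ltW.
have muc_in c j i : j \in I -> i \in D j -> muc c i = amp j (c j) i.
  move=> jI ij; rewrite /muc; case: pickP => [k /andP[kI ik]|/(_ j)]; last by rewrite jI ij.
  by rewrite (Iuniq jI kI ij ik).
(* The coin of block [k] is stored at [k], which lies in [D k] and hence outside any other chosen
   block [D j]; altering coins in [D j] leaves the outside amplitudes alone. *)
have muc_out c c' i j : j \in I -> i \notin D j ->
    (forall k, k \notin D j -> c k = c' k) -> muc c i = muc c' i.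
  move=> jI ij cc; rewrite /muc; case: pickP => // k /andP[kI ik].
  rewrite cc//; apply/negP => kj; move: ij; rewrite (Iuniq jI kI kj (VD k)) in ik *.
  by rewrite ik.
pose beta (x : {ffun 'I_p -> bool * bool}) : 'I_p -> R :=
  beta_of [ffun i => (x i).1] (muc (fun j => (x j).2)).
pose rr j x := fine (block_risk (D j) (beta x)).
have rr0 j x : 0 <= rr j x by rewrite fine_ge0.
pose q j := (4 ^+ K)^-1 * expR (- (Defs.eta vt r tau a Om (V j).1 (V j).2 * l)
  - (80 * B + 10) * h ^+ 3).
have blockq j : j \in I -> q j <= \sum_x W x * rr j x.
  move=> jI.
  pose E c (x : {ffun 'I_p -> bool * bool}) := [forall i in D j, x i == pattern j c i].
  (* The coin at [j] separates the two events even when the two supports coincide. *)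
  have Edis x : ~~ (E false x && E true x).
    apply/negP => /andP[/forall_inP hf /forall_inP ht].
    have := hf j (VD j); rewrite (eqP (ht j (VD j))) /pattern eqxx.
    by rewrite xpair_eqE /= andbF.
  apply: (@le_trans _ _ (\sum_(x | E false x) W x * rr j x + \sum_(x | E true x) W x * rr j
    x)); last first.
    rewrite [leRHS](bigID (E false))/= lerD2l [leRHS](bigID (E true))/=.
    rewrite (eq_bigl (fun x => ~~ E false x && E true x)).
      by rewrite lerDl; apply: sumr_ge0 => x _; rewrite mulr_ge0.
    by move=> x; have := Edis x; case: (E false x); case: (E true x).
  rewrite !(resample _ _ _ w_sum) -big_split/=.
  have -> : q j = \sum_x W x * q j by rewrite -mulr_suml W_sum mul1r.
  apply: ler_sum => x _; rewrite -mulrDr ler_wpM2l//.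
  pose y c : {ffun 'I_p -> bool * bool} := [ffun i => if i \in D j then pattern j c i else x i].
  apply: (@le_trans _ _ ((4 ^+ K)^-1 * expR (- (#|(V j).1|%:R * vt * l)) * rr j (y false) +
     (4 ^+ K)^-1 * expR (- (#|(V j).2|%:R * vt * l)) * rr j (y true))); last first.
    apply: lerD; apply: ler_wpM2r => //.
      exact: (pattern_weight j false).
    exact: (pattern_weight j true).
  rewrite /q -![_ * expR _ * rr _ _]mulrA -mulrDr ler_wpM2l ?invr_ge0 ?exprn_ge0//.
  have y_in c i : i \in D j -> beta (y c) i = (i \in if c then (V j).2 else (V j).1)%:R *
    amp j c i.
    move=> ij; rewrite /beta /beta_of (muc_in _ j)// !ffunE ij (VD j) /pattern /=.
    by rewrite eqxx.
  have y_out i : i \notin D j -> beta (y false) i = beta (y true) i.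
    move=> ij; rewrite /beta /beta_of !ffunE (negbTE ij); congr (_ * _).
    by apply: (muc_out _ _ _ j) => // k kj; rewrite !ffunE (negbTE kj).
  rewrite -lee_fin EFinD !EFinM !fineK//.
  exact: ((ampP j).2 (fun c => beta (y c)) y_in y_out).
pose P (b : {ffun 'I_p -> bool}) : R := \prod_i (if b i then eps else 1 - eps).
have P0 b : 0 <= P b by apply: prodr_ge0 => i _; have := eps_half; have := eps0;
  case: ifP => _; lra.
pose zip2 (b c : {ffun 'I_p -> bool}) : {ffun 'I_p -> bool * bool} := [ffun i => (b i, c i)].
pose risk (c : {ffun 'I_p -> bool}) := \sum_b P b * \sum_(j in I) rr j (zip2 b c).
have risk_le c : ((risk c)%:E <= Hamming_risk sigma est eps (muc c) Om)%E.
  rewrite /Hamming_risk /risk -sumEFin; apply: lee_sum => b _.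
  rewrite EFinM lee_wpmul2l ?lee_fin//.
  have -> : ((\sum_(j in I) rr j (zip2 b c))%:E =
     \sum_(j in I) block_risk (D j) (beta_of b (muc c)))%E.
    rewrite -sumEFin; apply: eq_bigr => j _; rewrite fineK//; congr block_risk.
    rewrite /beta; congr beta_of; first by apply/ffunP => i; rewrite !ffunE.
    by congr muc; apply/funext => i; rewrite ffunE.
  rewrite -designE_sum; last 2 first.
  - by move=> j X z; exact: sumr_ge0.
  - by move=> j; exact: sum_measurable.
  apply: (designE_le n0 posOm) => X z.
    by rewrite lee_fin; apply: sumr_ge0 => j _; exact: sumr_ge0.
  rewrite lee_fin natr_sum.
  by apply: (sum_disjoint_le (f := fun i => mism (beta_of b (muc c)) i X z)).
have avg : \sum_(j in I) q j <= (2 ^+ p)^-1 * \sum_c risk c.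
  apply: (@le_trans _ _ (\sum_x W x * \sum_(j in I) rr j x)).
    under [leRHS]eq_bigr do rewrite mulr_sumr.
    by rewrite exchange_big/=; apply: ler_sum.
  rewrite /risk exchange_big/= pair_bigA/= mulr_sumr.
  rewrite (reindex (fun bc => zip2 bc.1 bc.2))/=; last first.
    exists (fun x : {ffun 'I_p -> bool * bool} => ([ffun i => (x i).1], [ffun i => (x i).2])).
      by move=> [b c] _ /=; congr (_, _); apply/ffunP => i; rewrite !ffunE.
    by move=> x _ /=; apply/ffunP => i; rewrite !ffunE -surjective_pairing.
  apply: ler_sum => -[b c] _ /=; rewrite mulrA ler_wpM2r ?sumr_ge0//.
  rewrite /W /w big_split/= prodr_const card_ord exprVn mulrC ler_wpM2l//.
  by apply: ler_prod => i _; rewrite ffunE/= lexx andbT; case: ifP => _; have := eps_half;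
    have := eps0; lra.
have [c hc] : exists c, \sum_(j in I) q j <= risk c.
  apply/not_existsP => hn.
  move: avg; rewrite leNgt => /negP; apply.
  rewrite mulrC ltr_pdivrMr ?exprn_gt0//.
  have -> : (\sum_(j in I) q j) * 2 ^+ p = \sum_(c : {ffun 'I_p -> bool}) \sum_(j in I) q j.
    by rewrite sumr_const card_ffun card_bool card_ord -[RHS]mulr_natr natrX.
  apply: ltr_sum => [|c _]; last by rewrite ltNge; apply/negP/hn.
  by apply/hasP; exists [ffun=> false] => //; rewrite mem_index_enum.
exists (muc c); first exact: mucT.
by apply: le_trans (risk_le c); rewrite lee_fin.
Qed.

End RiskLowerBound.

(** * The logarithmic factor *)

Section Asymptotics.
Context {R : realType}.

Definition root4_log (p : nat) : R := Num.sqrt (Num.sqrt (ln p%:R)).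

Lemma root4_logE p : (0 < p)%N -> root4_log p ^+ 4 = ln p%:R.
Proof.
move=> p0; have l0 : 0 <= ln (p%:R : R) by rewrite ln_ge0// ler1n.
by rewrite /root4_log (_ : 4 = 2 * 2)%N// exprM !sqr_sqrtr ?sqrtr_ge0.
Qed.

Lemma root4_log_near (A : R) : \forall p \near \oo, (0 < p)%N /\ A <= root4_log p.
Proof.
pose A' := Num.max A 0.
have A'0 : 0 <= A' by rewrite le_max lexx orbT.
near=> p.
have p0 : (0 < p)%N by near: p; exists 1%N.
split=> //; apply: (@le_trans _ _ A'); first by rewrite le_max lexx.
rewrite -(@ler_pXn2r _ 4%N) ?nnegrE ?sqrtr_ge0// root4_logE//.
rewrite -[leLHS]expRK ler_ln ?posrE ?expR_gt0 ?ltr0n//.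
by near: p; exact: nbhs_infty_ger.
Unshelve. all: by end_near. Qed.

Lemma powR_natE p (x : R) : (0 < p)%N -> p%:R `^ x = expR (x * ln p%:R).
Proof. by move=> p0; rewrite /powR pnatr_eq0 eqn0Ngt p0. Qed.

(** Growth follows from [delta h^4 - C h^3 = h^3 (delta h - C)]; decay needs only the sign of
    [C]. *)
Lemma multi_log_root4 (C : R) : 0 <= C ->
  multi_log (fun p => expR (- (C * root4_log p ^+ 3))).
Proof.
move=> C0; split=> [p|delta d0]; first exact: expR_gt0.
split.
  apply/cvgryPge => A.
  near=> p.
  have [p0 h1] : (0 < p)%N /\ 1 <= root4_log p by near: p; exact: root4_log_near.
  have [_ hC] : (0 < p)%N /\ (C + 1) / delta <= root4_log p by near: p; exact: root4_log_near.
  have [_ hA] : (0 < p)%N /\ A <= root4_log p by near: p; exact: root4_log_near.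
  rewrite powR_natE// -expRD -root4_logE//; move: (root4_log p) h1 hC hA => h h1 hC hA.
  have hd : 1 <= delta * h - C by move: hC; rewrite ler_pdivrMr//; lra.
  have hh : h <= h ^+ 3 by rewrite -[leLHS]expr1 ler_weXn2l.
  apply: (@le_trans _ _ (expR h)).
    by apply: (le_trans hA); apply: le_trans (expR_ge1Dx _); lra.
  rewrite ler_expR; apply: (le_trans hh).
  rewrite (_ : - _ + _ = h ^+ 3 * (delta * h - C)); last by ring.
  by rewrite ler_peMr// exprn_ge0//; lra.
apply/cvgr0Pnorm_le => e e0.
near=> p.
have [p0 h1] : (0 < p)%N /\ 1 <= root4_log p by near: p; exact: root4_log_near.
have [_ hC] : (0 < p)%N /\ (delta * e)^-1 <= root4_log p by near: p; exact: root4_log_near.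
rewrite ger0_norm ?mulr_ge0 ?powR_ge0 ?expR_ge0//.
rewrite powR_natE// -expRD -root4_logE//; move: (root4_log p) h1 hC => h h1 hC.
apply: (@le_trans _ _ (expR (- (delta * h)))).
  rewrite ler_expR mulNr -opprD lerN2.
  have hh : h <= h ^+ 4 by rewrite -[leLHS]expr1 ler_weXn2l.
  have : delta * h <= delta * h ^+ 4 by rewrite ler_wpM2l// ltW.
  have : 0 <= C * h ^+ 3 by rewrite mulr_ge0// exprn_ge0//; lra.
  by lra.
have dh0 : 0 < delta * h by rewrite mulr_gt0//; lra.
rewrite expRN -[leRHS]invrK lef_pV2 ?posrE ?invr_gt0 ?expR_gt0//.
apply: le_trans (expR_ge1Dx _).
have : e^-1 <= delta * h.
  by move: hC; rewrite invfM mulrC ler_pdivrMr// mulrC.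
by lra.
Unshelve. all: by end_near. Qed.

End Asymptotics.

(** * The minimax bound from the greedy independent set *)

Theorem theorem6 (R : realType) (vt kappa r a sigma c0 : R) (m0 : nat)
  (Om : forall p : nat, 'M[R]_p) :
  0 < vt < 1 -> 0 < kappa < 1 -> 0 < r -> 1 <= a -> 1 - vt < kappa ->
  (0 < m0)%N -> 0 < c0 -> 0 < sigma ->
  (forall p : nat, correlation_matrix (Om p)) ->
  (\forall p \near \oo, Mclass c0 (g_index m0 vt r) (Om p)) ->
  forall V : forall p : nat, 'I_p -> {set 'I_p} * {set 'I_p},
  (forall (p : nat) (j : 'I_p),
     is_rho_minimizer vt r (tau_p sigma r p) a (Om p) j (V p j)) ->
  exists L : nat -> R, multi_log L /\
    \forall p \near \oo,
      ((L p / (maxn (golf_max_degree (V p)) 1)%:R *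
        \sum_(j < p) p%:R `^ (- rho_star vt r (tau_p sigma r p) a (Om p) j))%:E
       <= Hamm_star sigma vt kappa r a (Om p))%E.
Proof.
move=> /andP[vt0 _] /andP[kappa0 _] r0 a1 _ _ _ sigma0 hOm _ V hV.
pose B := vt + r / 4.
have B0 : 0 < B by rewrite addr_gt0// divr_gt0.
(* Each of the two supports has at most [B / vt] elements, so [K] bounds every block. *)
pose K := (Num.trunc (2 * B / vt)).+1.
have KB : 2 * B / vt <= K%:R by rewrite ltW// truncnS_gt.
have K4 : 0 < (4 : R) ^+ K by rewrite exprn_gt0.
(* The last term absorbs two constants: [4 ^+ K] from the pattern weights and 2 from the degree
   comparison. *)
pose C := 80 * B + 10 + 2 * 4 ^+ K.
have C0 : 0 <= C by rewrite /C; lra.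
exists (fun p => expR (- (C * root4_log p ^+ 3))); split; first exact: multi_log_root4.
near=> p.
have [p0 h1] : (0 < p)%N /\ 1 <= root4_log p :> R by near: p; exact: root4_log_near.
have [_ hvt] : (0 < p)%N /\ vt^-1 <= root4_log p by near: p; exact: root4_log_near.
have lh := @root4_logE R p p0.
set h := root4_log p in h1 hvt lh *; set l := ln (p%:R : R) in lh.
have h3 : 1 <= h ^+ 3 by rewrite exprn_ege1.
have l1 : 1 <= l by rewrite -lh exprn_ege1.
have l0 : 0 < l by lra.
set tau := tau_p sigma r p.
have n0 : (0 < n_p kappa p)%N.
  have pk : 1 <= p%:R `^ kappa :> R.
    by rewrite powR_natE// -[leLHS]expR0 ler_expR mulr_ge0// ltW.
  have : (1 <= Num.floor (p%:R `^ kappa : R))%R by rewrite floor_ge_int.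
  by rewrite absz_gt0; case: eqP => // ->.
have epsE : eps_p vt p = expR (- (vt * l)) by rewrite /eps_p powR_natE// mulNr.
have eps_half : eps_p vt p <= 1 / 2.
  have vl : 1 <= vt * l.
    have hh : h <= l by rewrite -lh -[leLHS]expr1 ler_weXn2l.
    have : vt * vt^-1 <= vt * l by rewrite (ler_wpM2l (ltW vt0))// (le_trans hvt).
    by rewrite mulfV ?gt_eqF.
  rewrite epsE expRN div1r lef_pV2 ?posrE ?expR_gt0//.
  by apply: le_trans (expR_ge1Dx _); lra.
pose D j : {set 'I_p} := ((V p j).1 :|: (V p j).2)%SET.
have VD j : j \in D j by case: (hV p j).
have Veta j : Defs.eta vt r tau a (Om p) (V p j).1 (V p j).2 = rho_star vt r tau a (Om p) j.
  by case: (hV p j).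
have VB j : Defs.eta vt r tau a (Om p) (V p j).1 (V p j).2 <= B.
  by rewrite Veta; exact: (rho_star_le vt0 r0 a1 sigma0 (hOm p) l0 erefl).
have DK j : (#|D j| <= K)%N.
  have al0 : 0 <= alpha_star tau a (Om p) (V p j).1 (V p j).2.
    exact: (alpha_star_ge0 a (hOm p)).
  have [_ b0 b1] := eta_separation_bound vt0 (mulr_ge0 al0 (ltW r0)) B0 (VB j).
  apply: leq_trans (leq_card_setU _ _) _.
  rewrite -(ler_nat R) natrD (le_trans _ KB)// ler_pdivlMr// mulrDl.
  by lra.
pose e j k := ~~ [disjoint D j & D k]%B.
have e_sym : symmetric e by move=> j k; rewrite /e disjoint_sym.
have edeg j : (#|[pred k | (k != j) && e j k]| <= golf_max_degree (V p))%N.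
  apply: leq_trans (leq_bigmax j); apply: subset_leq_card.
  by apply/fintype.subsetP => k; rewrite !inE.
pose w j := expR (- (rho_star vt r tau a (Om p) j * l)).
have w0 j : 0 <= w j by exact: expR_ge0.
have [I [_ Iind Iw]] := independent_set_weight e_sym edeg w0 finset.setT.
apply: le_ereal_inf_tmp => _ [est mest <-].
have Idis : {in I &, forall j k, k != j -> [disjoint D j & D k]%B}.
  by move=> j k jI kI kj; have := Iind j k jI kI kj; rewrite negbK.
have [mu muT risk_ge] := hamming_risk_lower vt0 r0 a1 sigma0 (hOm p) n0 l0 erefl mest
  epsE eps_half VD h1 (esym lh) VB DK Idis.
apply: (@le_trans _ _ (Hamming_risk sigma est (eps_p vt p) mu (Om p))); last first.
  by apply: ereal_sup_ubound; exists mu.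
apply: le_trans risk_ge; rewrite lee_fin.
have sumT : \sum_(j < p) p%:R `^ (- rho_star vt r tau a (Om p) j) =
    \sum_(j in finset.setT) w j.
  by apply: eq_big => [j|j _]; rewrite ?finset.in_setT// powR_natE// mulNr.
rewrite sumT; set m := (maxn _ 1)%:R : R.
have mpos : 0 < m by rewrite ltr0n leq_max orbT.
(* The greedy loss is [d + 1], at most twice [max (d, 1)]; the maximum with 1 covers a graph without
   edges. *)
have dm : (golf_max_degree (V p)).+1%:R <= 2 * m :> R.
  by rewrite /m -natrM ler_nat mul2n -addnn -addn1 leq_add ?leq_maxl ?leq_maxr.
have SI0 : 0 <= \sum_(j in I) w j by exact: sumr_ge0.
have Sall : \sum_(j in finset.setT) w j <= 2 * m * \sum_(j in I) w j.
  by apply: (le_trans Iw); rewrite ler_wpM2r.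
rewrite [leRHS](_ : _ = (4 ^+ K)^-1 * expR (- ((80 * B + 10) * h ^+ 3)) * \sum_(j in I) w j).
  apply: (@le_trans _ _ (2 * expR (- (C * h ^+ 3)) * \sum_(j in I) w j)).
    apply: (@le_trans _ _ (expR (- (C * h ^+ 3)) / m * (2 * m * \sum_(j in I) w j))).
      by rewrite ler_wpM2l// divr_ge0 ?expR_ge0// ltW.
    by rewrite le_eqVlt; apply/orP; left; apply/eqP; field; rewrite gt_eqF.
  rewrite ler_wpM2r//.
  rewrite (_ : - (C * h ^+ 3) = - (2 * 4 ^+ K * h ^+ 3) + - ((80 * B + 10) * h ^+ 3));
    last first.
    by rewrite /C; ring.
  rewrite expRD mulrA ler_wpM2r ?expR_ge0//.
  rewrite expRN ler_pdivrMr ?expR_gt0// mulrC ler_pdivlMr//.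
  apply: le_trans (expR_ge1Dx _).
  have : 2 * 4 ^+ K <= 2 * 4 ^+ K * h ^+ 3 by rewrite ler_peMr// mulr_ge0// ltW.
  by lra.
rewrite mulr_sumr; apply: eq_bigr => j _; rewrite expRD Veta /w.
by rewrite mulrAC mulrA.
Unshelve. all: by end_near. Qed.
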